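(* Let $m=(m_0,m_1,\dots)$ be a bounded sequence of integers with $m_k\ge 2$ for all $k$, let $G_m$ be the associated bounded Vilenkin group, and let $0<p\le 1$. Then there exists a martingale $f\in H_p(G_m)$ such that $$\|L^{*}f\|_{p}=+\infty,$$ where $L^{*}$ is the maximal operator of the Nörlund logarithmic means.
   Context: Notation: $\mathbb N_+=\{1,2,\dots\}$, $\mathbb N=\mathbb N_+\cup\{0\}$. Let $m=(m_0,m_1,\dots)$ be a sequence of integers $m_k\ge 2$ with $\sup_k m_k<\infty$. Let $Z_{m_k}=\{0,1,\dots,m_k-1\}$ be the additive group of integers modulo $m_k$ with the discrete topology. The (bounded) Vilenkin group $G_m$ is the complete direct product of the groups $Z_{m_k}$, with the product topology; its elements are sequences $x=(x_0,x_1,\dots)$ with $x_k\in Z_{m_k}$. The measure $\mu$ is the product of the measures $\mu_k(\{j\})=1/m_k$ ($j\in Z_{m_k}$), i.e. the Haar measure on $G_m$ with $\mu(G_m)=1$. Put $I_0(x)=G_m$ and $I_n(x)=\{y\in G_m: y_0=x_0,\dots,y_{n-1}=x_{n-1}\}$ for $n\in\mathbb N_+$. Put $M_0=1$, $M_{k+1}=m_kM_k$. Each $n\in\mathbb N$ is written uniquely as $n=\sum_{j\ge 0}n_jM_j$ with $n_j\in Z_{m_j}$, only finitely many $n_j$ nonzero. The generalized Rademacher functions are $r_k(x)=\exp(2\pi i x_k/m_k)$, and the Vilenkin system is $\psi_n(x)=\prod_{k\ge 0}r_k(x)^{n_k}$, $n\in\mathbb N$. For $0<p<\infty$, $\|g\|_p=\left(\int_{G_m}|g|^p\,d\mu\right)^{1/p}$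 is the (quasi)norm of $L_p(G_m)$. Let $\mathcal F_n$ be the $\sigma$-algebra generated by $\{I_n(x):x\in G_m\}$. A martingale $f=(f^{(n)},n\in\mathbb N)$ is a martingale with respect to $(\mathcal F_n)_{n\in\mathbb N}$ and $\mu$. Its maximal function is $f^{*}=\sup_{n\in\mathbb N}|f^{(n)}|$. The martingale Hardy space $H_p(G_m)$ consists of all martingales $f$ with $\|f\|_{H_p}:=\|f^{*}\|_{p}<\infty$. The Vilenkin-Fourier coefficients of a martingale $f$ are $\widehat f(i)=\lim_{k\to\infty}\int_{G_m}f^{(k)}\overline{\psi_i}\,d\mu$. The partial sums are $S_nf=\sum_{k=0}^{n-1}\widehat f(k)\psi_k$ for $n\in\mathbb N_+$, and $S_0f=0$. The Nörlund logarithmic means are $L_nf(x)=\frac1{l_n}\sum_{k=1}^{n-1}\frac{S_kf(x)}{n-k}$, where $l_n=\sum_{k=1}^{n}\frac1k$ ($n\in\mathbb N_+$; the empty sum is $0$), and the maximal operator is $L^{*}f(x)=\sup_{n\in\mathbb N_+}|L_nf(x)|$. *)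

(* Defs.v *)
From HB Require Import structures.
From mathcomp Require Import all_boot all_order all_algebra.
From mathcomp Require Import all_classical all_reals all_analysis.
From mathcomp Require Import measurable_realfun complex zify.
Set Implicit Arguments.
Unset Strict Implicit.
Unset Printing Implicit Defensive.
Import Order.TTheory GRing.Theory Num.Theory.
Import numFieldNormedType.Exports.
Local Open Scope classical_set_scope.
Local Open Scope ring_scope.
Local Open Scope complex_scope.

(* 'Z_(m k) is the group of integers modulo m k only when 1 < m k. *)
Definition vilenkin (m : nat -> nat) : Type := forall k, 'Z_(m k).

HB.instance Definition _ m := gen_eqMixin (vilenkin m).
HB.instance Definition _ m := gen_choiceMixin (vilenkin m).
HB.instance Definition _ m := isPointed.Build (vilenkin m) (fun=> 0).

Section vilenkin_structure.
Variable m : nat -> nat.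

Definition coordinate_sets : set (set (vilenkin m)) :=
  [set A | exists k (j : 'Z_(m k)), A = [set x | x k = j]].

(* The product sigma-algebra; there are countably many factors and each is
   finite and discrete, so it is also the Borel sigma-algebra of the product
   topology. *)
HB.instance Definition _ :=
  Measurable.copy (vilenkin m) (g_sigma_algebraType coordinate_sets).

Definition cylinder (n : nat) (x : vilenkin m) : set (vilenkin m) :=
  [set y | forall k, (k < n)%N -> y k = x k].

Definition cylinders (n : nat) : set (set (vilenkin m)) :=
  range (cylinder n).

Definition base (n : nat) : nat := (\prod_(k < n) m k)%N.

Definition digit (n k : nat) : nat := ((n %/ base k) %% m k)%N.

End vilenkin_structure.

Section analysis.
Variables (R : realType) (m : nat -> nat).

(* The factor k carries the uniform measure, which gives a subset A k of
   'Z_(m k) the mass #|A k| / m k. *)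
Definition is_product_measure (mu : set (vilenkin m) -> \bar R) : Prop :=
  forall (n : nat) (A : forall k, {set 'Z_(m k)}),
    mu [set x : vilenkin m | forall k, (k < n)%N -> x k \in A k] =
    (\prod_(k < n) (#|A k|%:R / (m k)%:R))%:E.

Definition rademacher (k : nat) (x : vilenkin m) : R[i] :=
  let t := 2 * pi * (x k : nat)%:R / (m k)%:R in cos t +i* sin t.

(* When all m k are at least 2, n < base m k for every k >= n, so the digits
   of n of rank k >= n vanish and the omitted factors are 1. *)
Definition psi (n : nat) (x : vilenkin m) : R[i] :=
  \prod_(k < n) rademacher k x ^+ digit m n k.

Variable mu : {measure set (vilenkin m) -> \bar R}.

Definition integralC (g : vilenkin m -> R[i]) : R[i] :=
  Rintegral mu setT (fun x => complex.Re (g x)) +i*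
  Rintegral mu setT (fun x => complex.Im (g x)).

Definition real_martingale (f : nat -> vilenkin m -> R) : Prop :=
  [/\ forall n, measurable_fun
        [set: g_sigma_algebraType (cylinders n)] (f n),
      forall n, mu.-integrable setT (EFin \o f n) &
      forall n k A, (n <= k)%N -> <<s cylinders n >> A ->
        Rintegral mu A (f k) = Rintegral mu A (f n)].

Definition martingale (f : nat -> vilenkin m -> R[i]) : Prop :=
  real_martingale (fun n x => complex.Re (f n x)) /\
  real_martingale (fun n x => complex.Im (f n x)).

Definition maximal_function (f : nat -> vilenkin m -> R[i])
    (x : vilenkin m) : \bar R :=
  ereal_sup [set (Normc.normc (f n x))%:E | n in [set: nat]].

Definition hardy_norm (p : R) (f : nat -> vilenkin m -> R[i]) : \bar R :=
  Lnorm mu p%:E (maximal_function f).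

Definition in_hardy (p : R) (f : nat -> vilenkin m -> R[i]) : Prop :=
  martingale f /\ (hardy_norm p f < +oo)%E.

(* For a martingale the sequence is constant as soon as i < base m k. *)
Definition fourier_coef (f : nat -> vilenkin m -> R[i]) (i : nat) : R[i] :=
  lim ((fun k : nat =>
    integralC (fun x => f k x * (psi i x)^*) : R[i]^o) @ \oo).

Definition partial_sum (f : nat -> vilenkin m -> R[i]) (n : nat)
    (x : vilenkin m) : R[i] :=
  \sum_(k < n) fourier_coef f k * psi k x.

Definition log_weight (n : nat) : R[i] := \sum_(1 <= k < n.+1) k%:R^-1.

Definition norlund_log_mean (f : nat -> vilenkin m -> R[i]) (n : nat)
    (x : vilenkin m) : R[i] :=
  (log_weight n)^-1 * \sum_(1 <= k < n) partial_sum f k x / (n - k)%:R.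

Definition norlund_log_maximal (f : nat -> vilenkin m -> R[i])
    (x : vilenkin m) : \bar R :=
  ereal_sup [set (Normc.normc (norlund_log_mean f n x))%:E |
    n in [set n : nat | (0 < n)%N]].

End analysis.

Lemma base0 m : base m 0 = 1%N. Proof. by rewrite /base big_ord0. Qed.

Lemma baseS m n : base m n.+1 = (base m n * m n)%N.
Proof. by rewrite /base big_ord_recr. Qed.

Section digits.
Variable m : nat -> nat.
Hypothesis m_ge2 : forall k, (2 <= m k)%N.

Lemma base_gt0 n : (0 < base m n)%N.
Proof. by rewrite prodn_gt0// => i; rewrite (leq_trans _ (m_ge2 i)). Qed.

Lemma base_gt n : (n < base m n)%N.
Proof.
elim: n => [|n ih]; first by rewrite base0.
rewrite baseS (@leq_trans (base m n * 2))//; last by rewrite leq_mul2l m_ge2 orbT.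
by rewrite muln2 -addnn -addn1 leq_add// base_gt0.
Qed.

Lemma digit_lt n k : (digit m n k < m k)%N.
Proof. by rewrite /digit ltn_mod (leq_trans _ (m_ge2 k)). Qed.

Lemma digit_ge n k : (n <= k)%N -> digit m n k = 0%N.
Proof.
move=> nk; rewrite /digit divn_small ?mod0n// (leq_trans (base_gt n))//.
rewrite /base -(subnKC nk); elim: (k - n)%N => [|j ih]; first by rewrite addn0.
rewrite addnS big_ord_recr/= (leq_trans ih)// leq_pmulr//.
exact: leq_trans (m_ge2 _).
Qed.

Lemma digit_modn n N : (\sum_(k < N) digit m n k * base m k)%N = (n %% base m N)%N.
Proof.
elim: N => [|N ih]; first by rewrite big_ord0 base0 modn1.
rewrite big_ord_recr/= ih /digit baseS.
have := divn_eq n (base m N); have := ltn_pmod n (base_gt0 N).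
have := divn_eq (n %/ base m N) (m N).
have := ltn_pmod (n %/ base m N) (leq_trans (ltn0Sn 1) (m_ge2 N)).
move: (n %% base m N)%N (n %/ base m N)%N => s d.
move: (d %/ m N)%N (d %% m N)%N => q r.
move=> rm -> sb ->.
by rewrite mulnDl -mulnA (mulnC (m N)) -addnA modnMDl modn_small; nia.
Qed.

Lemma digit_expansion n : n = (\sum_(k < n) digit m n k * base m k)%N.
Proof. by rewrite digit_modn modn_small// base_gt. Qed.

Lemma psi_widen (R : realType) (n N : nat) (x : vilenkin m) : (n <= N)%N ->
  psi R n x = \prod_(k < N) rademacher R k x ^+ digit m n k.
Proof.
move=> nN; rewrite /psi (big_ord_widen N (fun k => rademacher R k x ^+ digit m n k))//.
rewrite [LHS]big_mkcond; apply: eq_bigr => k _; case: ltnP => // nk.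
by rewrite digit_ge// expr0.
Qed.

End digits.

Section fibers.
Variable R : realType.

Lemma truncn_fiber_itv (M i : nat) : (0 < M)%N ->
  [set t : R | 0 <= t /\ Num.truncn (t * M%:R) = i] =
  [set` `[i%:R / M%:R, i.+1%:R / M%:R[].
Proof.
move=> M0; have M0' : 0 < M%:R :> R by rewrite ltr0n.
apply/seteqP; split => t /=.
  move=> [t0 /eqP]; rewrite truncn_eq ?mulr_ge0// => /andP[h1 h2].
  by rewrite in_itv/= ler_pdivrMr// h1 ltr_pdivlMr.
rewrite in_itv/= => /andP[h1 h2].
have t0 : 0 <= t by rewrite (le_trans _ h1)// divr_ge0.
split=> //; apply/eqP; rewrite truncn_eq ?mulr_ge0//.
by rewrite -ler_pdivrMr// h1 -ltr_pdivlMr.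
Qed.

Lemma truncn_lt (M : nat) (t : R) : (0 < M)%N -> 0 <= t ->
  (t < 1) = (Num.truncn (t * M%:R) < M)%N.
Proof.
move=> M0 t0; rewrite truncn_lt_nat ?mulr_ge0//.
have M0' : 0 < M%:R :> R by rewrite ltr0n.
by rewrite -[LHS](ltr_pM2r M0') mul1r.
Qed.

Lemma lebesgue_truncn (M : nat) (P : pred nat) : (0 < M)%N ->
  lebesgue_measure ([set t : R | P (Num.truncn (t * M%:R))] `&` [set` `[0, 1[]) =
  ((\sum_(0 <= i < M) (P i : nat))%:R / M%:R)%:E.
Proof.
move=> M0; have M0' : 0 < M%:R :> R by rewrite ltr0n.
have -> : [set t : R | P (Num.truncn (t * M%:R))] `&` [set` `[0, 1[] =
    \big[setU/set0]_(i < M | P i) (`[i%:R / M%:R, i.+1%:R / M%:R[%classic : set R).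
  rewrite big_mkcond/= -(bigcup_mkord _ (fun i => if P i then [set` `[i%:R / M%:R, i.+1%:R / M%:R[] else set0)); apply/seteqP; split => t /=.
    rewrite in_itv/= => -[Pt /andP[t0]]; rewrite (truncn_lt M0)// => tM.
    exists (Num.truncn (t * M%:R)) => //=.
    by rewrite Pt -truncn_fiber_itv.
  move=> [i /= iM]; case: ifPn => // Pi; rewrite -truncn_fiber_itv//= => -[t0 ti].
  by rewrite ti in_itv/= t0 (truncn_lt M0)// ti.
rewrite measure_bigsetU_ord//=; last first.
  apply/trivIsetP => /= i j _ _ ij; rewrite -!truncn_fiber_itv//.
  apply/seteqP; split => // t [/= [_ ti] [_ tj]].
  by move: ij; rewrite -val_eqE/= -ti -tj eqxx.
rewrite big_mkord natr_sum mulr_suml -sumEFin [in LHS]big_mkcond/=.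
apply: eq_bigr => i _; rewrite lebesgue_measure_itv/= lte_fin ltr_pM2r ?invr_gt0//.
rewrite ltr_nat ltnSn -EFinB -mulrBl -natrB// subSnn.
by case: (P i) => //; rewrite mul0r.
Qed.

Lemma measurable_truncn_fiber (M : nat) (P : pred nat) :
  measurable [set t : R | P (Num.truncn (t * M%:R))].
Proof.
have -> : [set t : R | P (Num.truncn (t * M%:R))] =
   \bigcup_(i in [set i | P i]) [set t : R | Num.truncn (t * M%:R) = i].
  apply/seteqP; split => t /=; first by move=> Pt; exists (Num.truncn (t * M%:R)).
  by move=> [i /= Pi ->].
apply: bigcup_measurable => i _.
have h j : measurable [set t : R | (Num.truncn (t * M%:R) <= j)%N].
  have -> : [set t : R | (Num.truncn (t * M%:R) <= j)%N] =
     setT `&` (fun t : R => t * M%:R) @^-1` `]-oo, j.+1%:R[.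
    by rewrite setTI; apply/seteqP; split => t /=; rewrite truncn_le_nat in_itv.
  have mf : measurable_fun setT (fun t : R => t * M%:R) by exact: mulrr_measurable.
  exact: mf.
case: i => [|i].
  rewrite [X in measurable X](_ : _ = [set t : R | (Num.truncn (t * M%:R) <= 0)%N])//.
  by apply/seteqP; split => t /=; rewrite leqn0 => /eqP.
rewrite [X in measurable X](_ : _ = [set t : R | (Num.truncn (t * M%:R) <= i.+1)%N]
   `\` [set t : R | (Num.truncn (t * M%:R) <= i)%N]); first exact: measurableD.
apply/seteqP; split => t /=; first by move=> ->; rewrite leqnn ltnn.
by move=> [h1 /negP]; rewrite -ltnNge => h2; apply/eqP; rewrite eqn_leq h1.
Qed.

End fibers.

Section existence.
Variables (R : realType) (m : nat -> nat).
Hypothesis m_ge2 : forall k, (2 <= m k)%N.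

(* Expansion of a real of [0, 1[ in the mixed radix m. The product measure is
   obtained as the image of Lebesgue measure on [0, 1[. *)
Definition real_digits (t : g_sigma_algebraType R.-ocitv.-measurable) : vilenkin m :=
  fun k => inZp (Num.truncn ((t : R) * (base m k.+1)%:R)).

Lemma measurable_real_digits : measurable_fun setT real_digits.
Proof.
have e : @measurable _ (vilenkin m) = <<s coordinate_sets (m := m) >> by [].
have h : preimage_set_system setT real_digits (coordinate_sets (m := m)) `<=`
    @measurable _ (g_sigma_algebraType R.-ocitv.-measurable).
  move=> _ [_ [k [j ->] <-]]; rewrite setTI.
  rewrite [X in measurable X](_ : _ = [set t : R | (fun i => inZp i == j :> 'Z_(m k))
    (Num.truncn (t * (base m k.+1)%:R))]); last first.
    by apply/seteqP; split => t /= /eqP.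
  exact: (@measurable_truncn_fiber R (base m k.+1) (fun i => inZp i == j :> 'Z_(m k))).
exact: (measurability _ e h).
Qed.

Fixpoint admissible (A : forall k, {set 'Z_(m k)}) (n N : nat) : bool :=
  if n is n'.+1 then
    admissible A n' (N %/ m n')%N && ((inZp N : 'Z_(m n')) \in A n')
  else true.

Lemma sum_admissible (A : forall k, {set 'Z_(m k)}) n :
  (\sum_(0 <= i < base m n) (admissible A n i : nat) = \prod_(k < n) #|A k|)%N.
Proof.
elim: n => [|n ih]; first by rewrite base0 big_ord0 big_nat1.
have mn0 : (0 < m n)%N by rewrite (leq_trans _ (m_ge2 n)).
rewrite baseS big_nat_mul big_ord_recr/= -ih big_distrl/=.
apply: eq_bigr => q _; rewrite mulSn -{1}[(q * m n)%N]add0n big_addn addnK.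
transitivity (\sum_(0 <= r < m n)
    (admissible A n q : nat) * ((inZp r : 'Z_(m n)) \in A n : nat))%N.
  apply: eq_big_nat => r /andP[_ rm].
  rewrite addnC divnMDl// divn_small// addn0 -mulnb.
  suff -> : (inZp (q * m n + r) : 'Z_(m n)) = inZp r by [].
  by apply: val_inj; rewrite /= Zp_cast// modnMDl.
rewrite -big_distrr/=; congr (_ * _)%N.
rewrite -{1}(Zp_cast (m_ge2 n)) big_mkord.
under eq_bigr do rewrite valZpK.
by rewrite -big_mkcond/= sum1_card.
Qed.

Lemma real_digits_rect (A : forall k, {set 'Z_(m k)}) n (t : R) : 0 <= t ->
  (forall k, (k < n)%N -> real_digits t k \in A k) <->
  admissible A n (Num.truncn (t * (base m n)%:R)).
Proof.
move=> t0; elim: n => [|n ih] /=; first by split.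
have -> : (Num.truncn (t * (base m n.+1)%:R) %/ m n)%N =
    Num.truncn (t * (base m n)%:R).
  have mn0 : (0 < m n)%N by rewrite (leq_trans _ (m_ge2 n)).
  have mn0' : 0 < (m n)%:R :> R by rewrite ltr0n.
  apply/esym/truncn_def.
  set u := Num.truncn _.
  have /andP[u1 u2] : u%:R <= t * (base m n.+1)%:R < u.+1%:R.
    by rewrite truncn_itv// mulr_ge0.
  rewrite baseS natrM mulrA in u1 u2.
  apply/andP; split; rewrite -(ler_pM2r mn0', ltr_pM2r mn0') -natrM.
    by rewrite (le_trans _ u1)// ler_nat leq_divM.
  by rewrite (lt_le_trans u2)// ler_nat ltn_ceil.
split=> [h|/andP[h1 h2] k].
  by apply/andP; split; [apply/ih => k kn; apply: h; exact: ltnW|exact: h].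
rewrite ltnS leq_eqVlt => /predU1P[->//|kn].
exact: ih.2 h1 k kn.
Qed.

Let m01 : measurable ([set` `[0, 1[] : set R). Proof. exact: measurable_itv. Qed.

Let unit_measure := mrestr (@lebesgue_measure R) m01.

HB.instance Definition _ := Measure.on unit_measure.

Let unit_measure_setT : unit_measure setT = 1%E.
Proof.
rewrite /unit_measure/= /mrestr/= setTI lebesgue_measure_itv/=.
by rewrite lte_fin ltr01 oppr0 adde0.
Qed.

HB.instance Definition _ :=
  Measure_isProbability.Build _ _ _ unit_measure unit_measure_setT.

HB.instance Definition _ :=
  isMeasurableFun.Build _ _ _ _ real_digits measurable_real_digits.

(* The hypothesis is_product_measure is satisfiable. *)
Lemma product_measure_exists :
  exists mu : probability (vilenkin m) R, is_product_measure mu.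
Proof.
exists (distribution unit_measure real_digits) => n A.
rewrite /= /distribution /pushforward/= /unit_measure /mrestr/=.
rewrite (_ : _ `&` _ = [set t : R | admissible A n (Num.truncn (t * (base m n)%:R))]
   `&` [set` `[0, 1[]).
  rewrite lebesgue_truncn ?base_gt0// sum_admissible; congr EFin.
  by rewrite prodf_div /base !natr_prod.
apply/seteqP; split => t /=; rewrite in_itv/= => -[h t01]; split=> //;
  case/andP: t01 => t0 _; [exact/real_digits_rect|exact/real_digits_rect].
Qed.

End existence.

(* Main.v *)
Require Import Defs.
From mathcomp Require Import all_boot all_order all_algebra.
From mathcomp Require Import all_classical all_reals all_analysis.
From mathcomp Require Import measurable_realfun complex.
From mathcomp Require Import zify ring lra.
Set Implicit Arguments.
Unset Strict Implicit.
Unset Printing Implicit Defensive.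
Import Order.TTheory GRing.Theory Num.Theory.
Import numFieldNormedType.Exports.
Local Open Scope classical_set_scope.
Local Open Scope ring_scope.
Local Open Scope complex_scope.

(** Write [M_j] for [base m j], [I_j] for the cylinder of rank [j] around the
    origin, [D_j] for the Dirichlet kernel of order [M_j], which is [M_j] on [I_j]
    and [0] elsewhere, and [b] for a bound of the sequence [m]. The martingale is
    [f^(n) = sum_(j < n) c_j (D_(j+1) - D_j)] with [c_j = (v_j M_j)^(1/p) / M_j];
    its Fourier coefficients are equal to [c_j] on the block of frequencies
    [M_j <= i < M_(j+1)] ([fourier_block_martingale_block]). The weights [v_j]
    are nonnegative and summable.

    The martingale belongs to [H_p]: for [p <= 1] the function [|f^(n)|^p] is at
    most [sum_j (c_j M_(j+1))^p 1_(I_j)], whose integral is at most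
    [b * sum_j v_j] ([hardy_norm_block_martingale], [block_coef_hardy]).

    The maximal operator is large: let [N = 2 K], let [t] be in [K, 2 K[, and take
    the mean of order [n = M_N + M_t] at a point [x] of [I_t]. The frequencies
    [M_N + s] with [s < M_t] all take the same value at [x], of modulus one
    ([psi_base_add]), hence [S_(M_N + s) f (x)] differs from [S_(M_N) f (x)] by a
    number of modulus [c_N s]. Now [sum_(s < M_t) s / (M_t - s)] is of order
    [M_t log M_t], that is at least of order [t M_t], while [l_n] is of order [N]
    because [m] is bounded; as [t >= N / 2], the logarithms balance. This gives
    [|L_n f (x)| >= k c_N M_t - B_N] with [k > 0] depending on [b] only, where [B_N]
    bounds the contribution of the blocks before the one of rank [N]
    ([norlund_log_maximal_lower]). Moreover [c_N M_t >= (v_N M_t)^(1/p)] because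
    [p <= 1]. If [B_N] is negligible, the integral of the [p]-th power over
    [I_t \ I_(t+1)] is at least a multiple of [v_N], for each of the [K] values of
    [t]: the integral of [(L^* f)^p] is at least a multiple of [v_N K]
    ([norlund_log_maximal_integral]).

    It remains to choose summable weights [v] for which [v_N K] is unbounded along
    ranks [N = 2 K] where it also dominates [B_N]. The weights [2^-k] at
    sufficiently sparse ranks do ([sparse_weights]), because [B_N] depends only on
    the weights placed before [N].

    Besides the measures of the cylinders, the only fact used about the measure is
    that each coordinate is uniform and independent of the preceding ones
    ([integralC_indep]): it gives both the martingale property and
    the Fourier coefficients of the [D_j]. *)

(** * Mixed radix digits and harmonic sums *)

Section base_digits.
Variable m : nat -> nat.
Hypothesis m_ge2 : forall k, (2 <= m k)%N.

Lemma base_dvdn i j : (i <= j)%N -> (base m i %| base m j)%N.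
Proof.
move=> ij; rewrite -(subnKC ij); elim: (j - i)%N => [|d ih]; first by rewrite addn0.
by rewrite addnS baseS dvdn_mulr.
Qed.

Lemma leq_base i j : (i <= j)%N -> (base m i <= base m j)%N.
Proof. by move=> ij; rewrite dvdn_leq ?base_gt0// base_dvdn. Qed.

Lemma leq_double_base n : (2 * base m n <= base m n.+1)%N.
Proof. by rewrite baseS mulnC leq_mul2l m_ge2 orbT. Qed.

Lemma digit_small i k : (i < base m k)%N -> digit m i k = 0%N.
Proof. by move=> ik; rewrite /digit divn_small// mod0n. Qed.

(** The leading digit of a frequency is the one used to prove orthogonality:
    the corresponding coordinate is independent of all those of lower rank. *)
Lemma leading_digit i : (0 < i)%N ->
  exists2 l, (base m l <= i < base m l.+1)%N & (0 < digit m i l < m l)%N.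
Proof.
move=> i0.
have ex : exists l, (i < base m l)%N by exists i; exact: base_gt.
case: (ex_minnP ex) => -[|l]; first by rewrite base0; case: i i0 {ex}.
move=> il min; have li : (base m l <= i)%N.
  by rewrite leqNgt; apply/negP => /min; rewrite ltnn.
exists l; first by rewrite li.
rewrite digit_lt// andbT /digit modn_small ?divn_gt0 ?base_gt0//.
by rewrite ltn_divLR ?base_gt0// mulnC -baseS.
Qed.

(** Below a top term [base m N] with digit one, adding [s < base m t] does not
    touch the digits of rank in [t, N[. *)
Lemma digit_add_base N t s k : (t <= N)%N -> (s < base m t)%N -> (t <= k)%N ->
  digit m (base m N + s) k = (k == N).
Proof.
move=> tN st tk; have sk : (s < base m k)%N by exact: leq_trans (leq_base tk).
case: (ltngtP k N) => [kN|Nk|->].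
- have /dvdnP[q ->] := base_dvdn kN.
  rewrite baseS mulnCA mulnC /digit divnMDl ?base_gt0// (divn_small sk) addn0.
  by rewrite modnMl.
- apply: digit_small; apply: leq_trans (leq_base Nk).
  apply: leq_trans (leq_double_base N); rewrite mul2n -addnn ltn_add2l.
  by rewrite (leq_trans st)// leq_base.
- rewrite /digit -[X in (X + s)%N]mul1n divnMDl ?base_gt0// divn_small.
    by rewrite addn0 modn_small// m_ge2.
  by rewrite (leq_trans st)// leq_base.
Qed.

End base_digits.

Section harmonic.
Variable R : realType.
Implicit Types n k : nat.

Definition harmonic_sum n : R := \sum_(1 <= k < n.+1) k%:R^-1.

Lemma harmonic_sumS n : harmonic_sum n.+1 = harmonic_sum n + n.+1%:R^-1.
Proof. by rewrite /harmonic_sum big_nat_recr. Qed.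

Lemma harmonic_sum_gt0 n : (0 < n)%N -> 0 < harmonic_sum n.
Proof.
case: n => // n _; elim: n => [|n ih].
  by rewrite /harmonic_sum big_nat1 invr1 ltr01.
by rewrite harmonic_sumS addr_gt0// invr_gt0 ltr0n.
Qed.

Lemma harmonic_sum_le n k : harmonic_sum n <= harmonic_sum (n + k).
Proof.
elim: k => [|k ih]; first by rewrite addn0.
by rewrite addnS harmonic_sumS (le_trans ih)// lerDl invr_ge0.
Qed.

Lemma harmonic_sum_upper M k : (0 < M)%N ->
  harmonic_sum (M + k) <= harmonic_sum M + k%:R / M%:R.
Proof.
move=> M0; elim: k => [|k ih]; first by rewrite addn0 mul0r addr0.
rewrite addnS harmonic_sumS -[k.+1%:R]natr1 mulrDl addrA lerD// mul1r.
by rewrite lef_pV2 ?posrE ?ltr0n// ler_nat -addnS leq_addr.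
Qed.

Lemma harmonic_sum_lower M k :
  harmonic_sum M + k%:R / (M + k)%:R <= harmonic_sum (M + k).
Proof.
have [->|k0] := posnP k; first by rewrite mul0r addr0 addn0.
(* the denominator has to stay fixed during the induction *)
have gen j : (j <= k)%N -> harmonic_sum M + j%:R / (M + k)%:R <= harmonic_sum (M + j).
  elim: j => [|j ih] jk; first by rewrite mul0r addr0 addn0.
  rewrite addnS harmonic_sumS -[j.+1%:R]natr1 mulrDl addrA lerD ?ih 1?ltnW// mul1r.
  by rewrite lef_pV2 ?posrE ?ltr0n ?addn_gt0 ?k0 ?orbT// ler_nat -addnS leq_add2l.
exact: gen.
Qed.

Variables (m : nat -> nat) (b : nat).
Hypothesis m_ge2 : forall k, (2 <= m k)%N.
Hypothesis m_le : forall k, (m k <= b)%N.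

(** Both bounds come from blocks: the indices in ]base m t, base m t.+1] add
    between [1 / 2] and [b] to the harmonic sum. *)
Lemma harmonic_base_ge t : 1 + t%:R / 2 <= harmonic_sum (base m t).
Proof.
elim: t => [|t ih].
  by rewrite base0 /harmonic_sum big_nat1 invr1 mul0r addr0.
have := leq_double_base m_ge2 t; have := base_gt0 m_ge2 t.
set M := base m t in ih * => M0 M2.
rewrite -(subnKC M2); apply: le_trans (harmonic_sum_le _ _).
rewrite mul2n -addnn; apply: le_trans (harmonic_sum_lower _ _).
rewrite -[t.+1%:R]natr1 mulrDl addrA lerD// addnn -mul2n natrM.
rewrite invfM mulrCA mulfV ?mulr1 ?mul1r//.
by rewrite pnatr_eq0 -lt0n.
Qed.

Lemma harmonic_base_le t : harmonic_sum (base m t) <= 1 + t%:R * b%:R.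
Proof.
elim: t => [|t ih].
  by rewrite base0 /harmonic_sum big_nat1 invr1 mul0r addr0.
have M0 := base_gt0 m_ge2 t; have M2 : (base m t <= base m t.+1)%N by rewrite leq_base.
rewrite -(subnKC M2); apply: le_trans (harmonic_sum_upper _ M0) _.
rewrite -[t.+1%:R]natr1 mulrDl mul1r addrA lerD// ler_pdivrMr ?ltr0n//.
by rewrite -natrM ler_nat baseS mulnC (leq_trans (leq_subr _ _))// leq_mul.
Qed.

End harmonic.

(** * Sparse weights *)

Section sparse_weights.
Variable R : realType.

(** The weights are [2^-k] at rank [2 e_(k+1)] and zero elsewhere. The [e_k] are
    chosen one after the other, so that [2^-k e_(k+1)] exceeds the sum of [k]
    and of the bound [F (2 e_k + 1)] attached to the part already built. *)
Lemma sparse_weights (F : nat -> R) : exists v : nat -> R,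
  [/\ forall j, 0 <= v j,
      forall n, \sum_(j < n) v j <= 2 &
      forall C : nat, exists n K, [/\ (n <= 2 * K)%N, (0 < K)%N,
        forall j, (n <= j < 2 * K)%N -> v j = 0 &
        C%:R + F n <= v (2 * K)%N * K%:R]].
Proof.
pose step (k a : nat) : nat :=
  (a + (Num.truncn (2 ^+ k * (k%:R + `|F (2 * a).+1|))).+1)%N.
pose e := fix e k := if k is k'.+1 then step k' (e k') else 0%N.
have eS k : (e k < e k.+1)%N by rewrite /= /step -addSnnS ltn_addr.
have e_ge k : (k <= e k)%N by elim: k => // k ih; exact: leq_ltn_trans (eS k).
have e_lt : {homo e : i j / (i < j)%N}.
  by apply: homo_ltn => //; exact: ltn_trans.
have e_le : {homo e : i j / (i <= j)%N} by apply: ltnW_homo.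
pose v j : R := \sum_(k < j | (2 * e k.+1 == j)%N) 2 ^- k.
exists v; split=> [j|n|C].
- by apply: sumr_ge0 => k _; rewrite invr_ge0 exprn_ge0.
- have -> : \sum_(j < n) v j =
      \sum_(j < n) \sum_(k < n | (k < j)%N && (2 * e k.+1 == j)%N) 2 ^- k :> R.
    apply: eq_bigr => j _; rewrite /v.
    rewrite (big_ord_widen_cond n (fun k => 2 * e k.+1 == j)%N
      (fun k => 2 ^- k : R)) 1?ltnW//.
    by apply: eq_bigl => k; rewrite andbC.
  rewrite (exchange_big_dep predT)//=.
  apply: (@le_trans _ _ (\sum_(k < n) 2 ^- k)).
    apply: ler_sum => k _; rewrite big_mkcond/=.
    have [kn|nk] := ltnP (2 * e k.+1)%N n.
      rewrite (bigD1 (Ordinal kn))//= big1 => [|j].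
        by case: ifP => _; rewrite addr0// invr_ge0 exprn_ge0.
      by rewrite -val_eqE/= eq_sym => /negbTE ->; rewrite andbF.
    rewrite big1 ?invr_ge0 ?exprn_ge0// => j _.
    by rewrite (gtn_eqF (leq_trans (ltn_ord j) nk)) andbF.
  have -> : \sum_(k < n) 2 ^- k = 2 - 2 * 2 ^- n :> R.
    elim: n => [|n ih]; first by rewrite big_ord0 expr0 invr1; lra.
    by rewrite big_ord_recr/= ih exprS invfM; lra.
  by rewrite gerBl mulr_ge0// invr_ge0 exprn_ge0.
- exists (2 * e C).+1, (e C.+1); split.
  + by rewrite ltn_mul2l eS.
  + exact: leq_ltn_trans (eS C).
  + move=> j /andP[h1 h2]; rewrite /v big1// => -[k /= _] /eqP kj; exfalso.
    move: h1 h2; rewrite -kj !ltn_mul2l /= => h1 h2.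
    have kC : (k < C)%N.
      rewrite ltnNge; apply/negP => Ck; have : (C.+1 <= k.+1)%N by [].
      by move=> /e_le; rewrite leqNgt h2.
    by move: (leq_trans h1 (e_le _ _ kC)); rewrite ltnn.
  + have hv : 2 ^- C <= v (2 * e C.+1)%N.
      have CK : (C < 2 * e C.+1)%N by rewrite (leq_trans (e_ge C.+1))// leq_pmull.
      rewrite /v (bigD1 (Ordinal CK))//= lerDl.
      by apply: sumr_ge0 => k _; rewrite invr_ge0 exprn_ge0.
    apply: (@le_trans _ _ (2 ^- C * (e C.+1)%:R)); last by rewrite ler_wpM2r.
    rewrite ler_pdivlMl ?exprn_gt0//.
    apply: (@le_trans _ _ (2 ^+ C * (C%:R + `|F (2 * e C).+1|))).
      by rewrite ler_wpM2l ?exprn_ge0// lerD2l ler_norm.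
    apply/ltW/(lt_le_trans (truncnS_gt _)).
    by rewrite ler_nat /= /step leq_addl.
Qed.

End sparse_weights.

(** * Functions of finitely many coordinates *)

Section finitely_many_values.
Context d (T : measurableType d) (R : realType).
Variables (mu : {finite_measure set T -> \bar R}) (I : finType) (phi : T -> I).
Hypothesis mphi : forall i, measurable (phi @^-1` [set i]).

Lemma indic_sum_fibers (F : I -> R) (x : T) :
  F (phi x) = \sum_i F i * \1_(phi @^-1` [set i]) x.
Proof.
rewrite (bigD1 (phi x))//= indicE mem_set// mulr1 big1 ?addr0// => i ix.
by rewrite indicE memNset ?mulr0// => /= xi; rewrite xi eqxx in ix.
Qed.

Let integrable_term (F : I -> R) i :
  mu.-integrable setT (fun x => (F i * \1_(phi @^-1` [set i]) x)%:E).
Proof.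
apply: (integrableZl measurableT (F i) (f := fun x => (\1_(phi @^-1` [set i]) x)%:E)).
exact: integrable_indic.
Qed.

Lemma integrable_finite_range (F : I -> R) :
  mu.-integrable setT (EFin \o (F \o phi)).
Proof.
rewrite [X in mu.-integrable _ X](_ : _ = fun x =>
    (\sum_i (F i * \1_(phi @^-1` [set i]) x)%:E)%E).
  by apply: integrable_sum => // i _; exact: integrable_term.
by apply/funext => x /=; rewrite sumEFin -indic_sum_fibers.
Qed.

Lemma Rintegral_finite_range (F : I -> R) :
  Rintegral mu setT (F \o phi) = \sum_i F i * fine (mu (phi @^-1` [set i])).
Proof.
rewrite /Rintegral.
transitivity (fine (\sum_i (F i * fine (mu (phi @^-1` [set i])))%:E)%E); last first.
  by rewrite sumEFin.
congr fine.
transitivity (\int[mu]_x (\sum_i (F i * \1_(phi @^-1` [set i]) x)%:E))%E.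
  by apply: eq_integral => x _; rewrite sumEFin -indic_sum_fibers.
rewrite integral_sum//.
apply: eq_bigr => i _; under eq_integral do rewrite EFinM.
rewrite integralZl//; last exact: integrable_indic.
by rewrite integral_indic// setIT EFinM fineK// fin_num_measure.
Qed.

End finitely_many_values.

Section finite_levels.
Variable m : nat -> nat.
Local Notation G := (vilenkin m).

(** Functions of the first [n] coordinates, that is, the functions measurable
    with respect to the finite algebra generated by the cylinders of rank [n]. *)
Definition level (n : nat) (S : Type) (g : G -> S) : Prop :=
  forall x y, (forall k, (k < n)%N -> x k = y k) -> g x = g y.

Lemma level_le n n' S (g : G -> S) : (n <= n')%N -> level n g -> level n' g.
Proof. by move=> nn' lg x y xy; apply: lg => k kn; rewrite xy// (leq_trans kn). Qed.

Lemma level_cst n S (s : S) : level n (fun=> s).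
Proof. by []. Qed.

Lemma level_op1 n S1 S (op : S1 -> S) (g1 : G -> S1) :
  level n g1 -> level n (fun x => op (g1 x)).
Proof. by move=> l1 x y xy; rewrite (l1 _ _ xy). Qed.

Lemma level_op2 n S1 S2 S (op : S1 -> S2 -> S) (g1 : G -> S1) (g2 : G -> S2) :
  level n g1 -> level n g2 -> level n (fun x => op (g1 x) (g2 x)).
Proof. by move=> l1 l2 x y xy; rewrite (l1 _ _ xy) (l2 _ _ xy). Qed.

Lemma level_big n S (op : S -> S -> S) (s0 : S) (I : Type) (r : seq I) (P : pred I)
    (g : I -> G -> S) :
  (forall i, P i -> level n (g i)) -> level n (fun x => \big[op/s0]_(i <- r | P i) g i x).
Proof. by move=> lg x y xy; apply: eq_bigr => i Pi; exact: lg. Qed.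

(** The possible values of the first [n] coordinates form a finite type, which
    indexes the cylinders of rank [n] and turns integrals into finite sums. *)
Definition prefixes n := {dffun forall k : 'I_n, 'Z_(m k)}.

Definition truncate n (x : G) : prefixes n := finfun (fun k : 'I_n => x k).

Definition pad n (t : prefixes n) : G := fun k =>
  if pselect (k < n)%N is left kn then t (Ordinal kn) else 0.

Lemma padE n (t : prefixes n) k (kn : (k < n)%N) : pad t k = t (Ordinal kn).
Proof. by rewrite /pad; case: pselect => // kn'; rewrite (bool_irrelevance kn' kn). Qed.

Lemma truncate_eq n x (t : prefixes n) :
  truncate n x = t <-> forall k, (k < n)%N -> x k = pad t k.
Proof.
split=> [<- k kn|xt]; first by rewrite (padE _ kn) ffunE.
by apply/ffunP => -[k kn]; rewrite ffunE -(padE t kn) -xt.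
Qed.

Lemma level_truncate n S (g : G -> S) (x : G) :
  level n g -> g x = g (pad (truncate n x)).
Proof. by apply; apply/truncate_eq. Qed.

Lemma truncate_cylinder n (t : prefixes n) :
  truncate n @^-1` [set t] = cylinder n (pad t).
Proof. by apply/seteqP; split => x /= /truncate_eq. Qed.

Lemma level_set_bigcup n (A : set G) : level n A ->
  A = \bigcup_(t in [set t : prefixes n | A (pad t)]) cylinder n (pad t).
Proof.
move=> lA; apply/seteqP; split => [x Ax|x [t /= At xt]].
  exists (truncate n x) => /=; first by rewrite -(level_truncate _ lA).
  by rewrite -truncate_cylinder.
by rewrite (lA _ (pad t)).
Qed.

(** The sets depending on the first [n] coordinates form a sigma-algebra and are
    finite unions of cylinders, hence the sigma-algebra of the martingale at
    time [n] is explicit. *)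
Lemma sigma_cylinders_level n (A : set G) : <<s cylinders n >> A <-> level n A.
Proof.
split.
  apply: (@smallest_sub _ (sigma_algebra setT) (cylinders n) [set B | level n B]).
  - split => [|B lB|F lF]; first by move=> x y.
    + by rewrite setTD => x y xy; rewrite /= /setC/= (lB _ _ xy).
    + move=> x y xy; apply/propext; split => -[i _ Fi]; exists i => //.
        by rewrite -(lF i _ _ xy).
      by rewrite (lF i _ _ xy).
  - move=> _ [z _ <-] x y xy; apply/propext.
    by split => h k kn; rewrite -h// xy.
move=> /level_set_bigcup ->.
apply: (@fin_bigcup_measurable _ (g_sigma_algebraType (cylinders n)) _
  [set t : prefixes n | A (pad t)] (fun t => cylinder n (pad t))) => [|t _].
  exact: finite_finset.
by apply: sub_sigma_algebra; exists (pad t).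
Qed.

Lemma measurable_coordinate k (j : 'Z_(m k)) : measurable [set x : G | x k = j].
Proof. by apply: sub_sigma_algebra; exists k, j. Qed.

Lemma measurable_cylinder n (z : G) : measurable (cylinder n z).
Proof.
have -> : cylinder n z = \bigcap_(k in `I_n) [set x : G | x k = z k].
  by apply/seteqP; split => x h k; exact: h.
by apply: bigcap_measurableType => k _; exact: measurable_coordinate.
Qed.

End finite_levels.

(** * Independence of the coordinates *)

Section product_measure.
Variables (R : realType) (m : nat -> nat).
Hypothesis m_ge2 : forall k, (2 <= m k)%N.
Variable mu : probability (vilenkin m) R.
Hypothesis mu_product : is_product_measure mu.
Local Notation G := (vilenkin m).
Local Notation C := R[i].

Lemma natr_base n : (base m n)%:R = \prod_(k < n) (m k)%:R :> R.
Proof. by rewrite /base natr_prod. Qed.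

Lemma natr_base_gt0 n : 0 < (base m n)%:R :> R.
Proof. by rewrite ltr0n base_gt0. Qed.

Lemma measure_cylinder n (z : G) : mu (cylinder n z) = ((base m n)%:R^-1)%:E.
Proof.
have -> : cylinder n z = [set x | forall k, (k < n)%N -> x k \in [set z k]%SET].
  by apply/seteqP; split => x h k kn; have := h k kn; rewrite inE => /eqP.
rewrite mu_product; congr EFin; rewrite natr_base -prodfV.
by apply: eq_bigr => k _; rewrite cards1 mul1r.
Qed.

Lemma integralC_finite_range (I : finType) (phi : G -> I) (F : I -> C) :
  (forall i, measurable (phi @^-1` [set i])) ->
  integralC mu (F \o phi) = \sum_i F i * (fine (mu (phi @^-1` [set i])))%:C.
Proof.
move=> mphi; rewrite /integralC.
have re := Rintegral_finite_range mu mphi (fun i => complex.Re (F i)).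
have im := Rintegral_finite_range mu mphi (fun i => complex.Im (F i)).
rewrite [X in X +i* _]re [X in _ +i* X]im.
elim/big_rec3: _ => [//|i z1 z2 z3 _ <-].
by case: (F i) => a b; simpc.
Qed.

Lemma truncate_measurable n (t : prefixes m n) : measurable (truncate n @^-1` [set t]).
Proof. by rewrite truncate_cylinder; exact: measurable_cylinder. Qed.

Lemma integrable_level n (g : G -> R) : level n g -> mu.-integrable setT (EFin \o g).
Proof.
move=> lg; have -> : g = (fun t => g (pad t)) \o truncate n.
  by apply/funext => x; exact: level_truncate.
by apply: integrable_finite_range => t; exact: truncate_measurable.
Qed.

Lemma integralC_level n (g : G -> C) : level n g ->
  integralC mu g = (\sum_(t : prefixes m n) g (pad t)) / (base m n)%:R.
Proof.
move=> lg; have {1}-> : g = (fun t => g (pad t)) \o truncate n.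
  by apply/funext => x; exact: level_truncate.
rewrite integralC_finite_range => [|t]; last exact: truncate_measurable.
rewrite mulr_suml; apply: eq_bigr => t _; congr (_ * _).
by rewrite truncate_cylinder measure_cylinder/= fmorphV rmorph_nat.
Qed.

Lemma integralCD n (g1 g2 : G -> C) : level n g1 -> level n g2 ->
  integralC mu (fun x => g1 x + g2 x) = integralC mu g1 + integralC mu g2.
Proof.
move=> l1 l2; have l12 := level_op2 +%R l1 l2.
by rewrite (integralC_level l1) (integralC_level l2) (integralC_level l12) big_split/= mulrDl.
Qed.

Lemma integralCZ n (c : C) (g : G -> C) : level n g ->
  integralC mu (fun x => c * g x) = c * integralC mu g.
Proof.
move=> l1; have l2 := level_op1 ( *%R c) l1.
by rewrite (integralC_level l1) (integralC_level l2) -mulr_sumr mulrA.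
Qed.

Lemma integralC_sum n (I : Type) (r : seq I) (g : I -> G -> C) :
  (forall i, level n (g i)) ->
  integralC mu (fun x => \sum_(i <- r) g i x) = \sum_(i <- r) integralC mu (g i).
Proof.
move=> lg; have ls : level n (fun x => \sum_(i <- r) g i x) by apply: level_big.
rewrite (integralC_level ls) exchange_big/= mulr_suml.
by apply: eq_bigr => i _; rewrite (integralC_level (lg i)).
Qed.

Lemma measure_truncate_coord n (t : prefixes m n) (a : 'Z_(m n)) :
  mu [set x | truncate n x = t /\ x n = a] = ((base m n.+1)%:R^-1)%:E.
Proof.
(* [val] compares elements of 'Z_(m k) and 'Z_(m n) without a cast *)
pose A k : {set 'Z_(m k)} :=
  if k == n then [set j | val j == val a]%SET else [set pad t k]%SET.
have An : A n = [set a]%SET.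
  by rewrite /A eqxx; apply/setP => j; rewrite !inE val_eqE.
have Ak k : (k < n)%N -> A k = [set pad t k]%SET by rewrite /A => /ltn_eqF ->.
have -> : [set x | truncate n x = t /\ x n = a] =
    [set x | forall k, (k < n.+1)%N -> x k \in A k].
  apply/seteqP; split => [x [/truncate_eq xt xa] k|x h].
    rewrite ltnS leq_eqVlt => /predU1P[->|kn]; first by rewrite An xa inE.
    by rewrite Ak// xt// inE.
  split; last by have := h n (ltnSn n); rewrite An inE => /eqP.
  by apply/truncate_eq => k kn; have := h k (ltnW kn); rewrite Ak// inE => /eqP.
rewrite mu_product; congr EFin; rewrite natr_base -prodfV; apply: eq_bigr => -[k /= kn] _.
move: kn; rewrite ltnS leq_eqVlt => /predU1P[->|kn]; first by rewrite An cards1 mul1r.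
by rewrite Ak// cards1 mul1r.
Qed.

(** The coordinate of rank [n] is uniform and independent of the previous ones;
    this is the only feature of the product measure behind both the martingale
    property and the orthogonality of the Vilenkin system. *)
Lemma integralC_indep n (g : G -> C) (h : 'Z_(m n) -> C) : level n g ->
  integralC mu (fun x => g x * h (x n)) =
  integralC mu g * ((\sum_a h a) / (m n)%:R).
Proof.
move=> lg; pose phi (x : G) := (truncate n x, x n).
pose F (ta : prefixes m n * 'Z_(m n)) := g (pad ta.1) * h ta.2.
have fib ta : phi @^-1` [set ta] = [set x | truncate n x = ta.1 /\ x n = ta.2].
  by case: ta => t a; apply/seteqP; split => x; rewrite /phi/= => -[-> ->].
have -> : (fun x => g x * h (x n)) = F \o phi.
  by apply/funext => x; rewrite /F/= [in LHS](level_truncate _ lg).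
rewrite integralC_finite_range => [|ta]; last first.
  rewrite fib; apply: measurableI; first exact: truncate_measurable.
  exact: measurable_coordinate.
rewrite (integralC_level lg) mulrACA big_distrlr/= pair_big/= mulr_suml.
apply: eq_bigr => -[t a] _; rewrite fib measure_truncate_coord/= /F/=; congr (_ * _).
by rewrite baseS natrM invfM rmorphM !fmorphV !rmorph_nat.
Qed.

End product_measure.

(** * Vilenkin functions and Dirichlet kernels *)

Section vilenkin_functions.
Variables (R : realType) (m : nat -> nat).
Hypothesis m_ge2 : forall k, (2 <= m k)%N.
Local Notation G := (vilenkin m).
Local Notation C := R[i].

Definition cis (t : R) : C := cos t +i* sin t.

Lemma cisD s t : cis (s + t) = cis s * cis t.
Proof. by rewrite /cis cosD sinD; simpc; rewrite addrC (addrC (sin s * _)). Qed.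

Lemma cis_exp t n : cis t ^+ n = cis (t *+ n).
Proof.
elim: n => [|n ih]; first by rewrite expr0 mulr0n /cis cos0 sin0.
by rewrite exprS mulrS cisD ih.
Qed.

Lemma normc_cis t : `|cis t| = 1.
Proof. by rewrite normc_def/= cos2Dsin2 sqrtr1. Qed.

Lemma cis_neq1 t : 0 < t -> t < 2 * pi -> cis t != 1.
Proof.
move=> t0 t2; apply/negP; rewrite /cis eq_complex/= => /andP[/eqP c1 _].
have s0 : 0 < sin (t / 2) by apply: sin_gt0_pi; lra.
have := cos2Dsin2 (t / 2); move: c1; rewrite {1}(splitr t) cosD.
by move=> c1 c2; nra.
Qed.

(** The primitive root of unity of order [m k] generating the values of the
    Rademacher function of rank [k]. *)
Definition zeta k : C := cis (2 * pi / (m k)%:R).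

Let m_gt0 k : 0 < (m k)%:R :> R.
Proof. by rewrite ltr0n (leq_trans _ (m_ge2 k)). Qed.

Lemma rademacherE k (x : G) : rademacher R k x = zeta k ^+ x k.
Proof.
rewrite /rademacher /zeta cis_exp.
suff -> : 2 * pi * (x k : nat)%:R / (m k)%:R = 2 * pi / (m k)%:R *+ x k :> R by [].
by rewrite -[RHS]mulr_natr mulrAC.
Qed.

Lemma zeta_exp_order k : zeta k ^+ m k = 1.
Proof.
rewrite /zeta cis_exp -[_ *+ m k]mulr_natr mulfVK ?gt_eqF// /cis mulrC mulr_natr.
by rewrite cos2pi sin2pi.
Qed.

Lemma zeta_exp_neq1 k e : (0 < e < m k)%N -> zeta k ^+ e != 1.
Proof.
move=> /andP[e0 em]; rewrite /zeta cis_exp -[_ *+ e]mulr_natr; apply: cis_neq1.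
  by rewrite !mulr_gt0 ?pi_gt0 ?invr_gt0 ?m_gt0// ltr0n.
by rewrite mulrAC ltr_pdivrMr// ltr_pM2l ?mulr_gt0 ?pi_gt0// ltr_nat.
Qed.

Lemma normc_rademacher k (x : G) : `|rademacher R k x| = 1.
Proof. by rewrite rademacherE normrX normc_cis expr1n. Qed.

Lemma sum_rademacher_digit k e : (0 < e < m k)%N ->
  \sum_(a : 'Z_(m k)) ((zeta k ^+ a) ^+ e)^* = 0.
Proof.
move=> he; set w := (zeta k ^+ e)^*.
have -> : \sum_(a : 'Z_(m k)) ((zeta k ^+ a) ^+ e)^* = \sum_(a < m k) w ^+ a.
  transitivity (\sum_(a < (Zp_trunc (m k)).+2) w ^+ a).
    2: by rewrite (Zp_cast (m_ge2 k)).
  apply: eq_bigr => a _.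
  by rewrite /w -rmorphXn -!exprM mulnC.
have w1 : w - 1 != 0.
  rewrite subr_eq0 /w -(conjc1 R) (inj_eq (can_inj (@conjcK R))).
  exact: zeta_exp_neq1.
apply: (mulfI w1); rewrite mulr0 -subrX1 /w -rmorphXn -exprM mulnC exprM.
by rewrite zeta_exp_order expr1n rmorph1 subrr.
Qed.

Lemma psi_prefix n i (x : G) : (i < base m n)%N ->
  psi R i x = \prod_(k < n) rademacher R k x ^+ digit m i k.
Proof.
move=> im; rewrite (psi_widen m_ge2 R x (leq_maxl i n)).
rewrite (big_ord_widen (maxn i n) (fun k => rademacher R k x ^+ digit m i k) (leq_maxr i n)).
rewrite [RHS]big_mkcond/=; apply: eq_bigr => k _; case: ltnP => // nk.
by rewrite digit_small ?expr0// (leq_trans im)// leq_base.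
Qed.

Lemma level_rademacher n k : (k < n)%N -> level n (fun x : G => rademacher R k x).
Proof.
move=> kn x y xy; rewrite !rademacherE.
by rewrite xy.
Qed.

Lemma level_psi n i : (i < base m n)%N -> level n (fun x : G => psi R i x).
Proof.
move=> im x y xy; rewrite !(psi_prefix _ im); apply: eq_bigr => k _.
by rewrite (level_rademacher (ltn_ord k) xy).
Qed.

Lemma normc_psi i (x : G) : `|psi R i x| = 1.
Proof. by rewrite normr_prod big1// => k _; rewrite normrX normc_rademacher expr1n. Qed.

Definition origin : G := fun=> 0.

Lemma rademacher_cylinder n k (x : G) :
  cylinder n origin x -> (k < n)%N -> rademacher R k x = 1.
Proof. by move=> xn kn; rewrite rademacherE xn// expr0. Qed.

Lemma psi_cylinder n i (x : G) :
  (i < base m n)%N -> cylinder n origin x -> psi R i x = 1.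
Proof.
move=> im xn; rewrite (psi_prefix _ im) big1// => k _.
by rewrite (rademacher_cylinder xn)// expr1n.
Qed.

(** Near the origin the frequencies in [base m N, base m N + base m t[ all give
    the same function, so that nothing cancels when they are summed. *)
Lemma psi_base_add N t s (x : G) : (t <= N)%N -> (s < base m t)%N ->
  cylinder t origin x -> psi R (base m N + s) x = rademacher R N x.
Proof.
move=> tN st xt; have sN : (base m N + s < base m N.+1)%N.
  apply: leq_trans (leq_double_base m_ge2 N); rewrite mul2n -addnn ltn_add2l.
  by rewrite (leq_trans st)// leq_base.
rewrite (psi_prefix _ sN) big_ord_recr/= (digit_add_base m_ge2 tN st tN) eqxx expr1.
rewrite big1 ?mul1r// => k _; have [kt|tk] := ltnP k t.
  by rewrite (rademacher_cylinder xt)// expr1n.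
by rewrite (digit_add_base m_ge2 tN st tk) ltn_eqF// expr0.
Qed.

(** The sum of the Vilenkin functions of index smaller than [base m n], in the
    closed form; [fourier_dirichlet] recovers its Fourier coefficients. *)
Definition dirichlet n (x : G) : R := (base m n)%:R * \1_(cylinder n origin) x.

Lemma dirichlet_in n x : cylinder n origin x -> dirichlet n x = (base m n)%:R.
Proof. by move=> xn; rewrite /dirichlet indicE mem_set// mulr1. Qed.

Lemma dirichlet_notin n x : ~ cylinder n origin x -> dirichlet n x = 0.
Proof. by move=> xn; rewrite /dirichlet indicE memNset// mulr0. Qed.

Lemma level_cylinder n (z : G) : level n (fun x => cylinder n z x).
Proof. by move=> x y xy; apply/propext; split => h k kn; rewrite -h// xy. Qed.

Lemma level_dirichlet n : level n (dirichlet n).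
Proof.
apply: level_op1 => x y xy; rewrite !indicE; congr (_ %:R); congr nat_of_bool.
by apply/idP/idP; rewrite !inE (level_cylinder _ xy).
Qed.

Lemma cylinderS n (z x : G) :
  cylinder n.+1 z x <-> cylinder n z x /\ x n = z n.
Proof.
split=> [h|[h xn] k]; first by split=> [k kn|]; apply: h => //; exact: ltnW.
by rewrite ltnS leq_eqVlt => /predU1P[->//|]; exact: h.
Qed.

Lemma dirichletS n x : dirichlet n.+1 x = dirichlet n x * ((x n == 0)%:R * (m n)%:R).
Proof.
have [xn|xn] := pselect (cylinder n origin x); last first.
  by rewrite !dirichlet_notin ?mul0r// => /cylinderS[].
rewrite (dirichlet_in xn); case: eqP => x0.
  by rewrite dirichlet_in ?baseS ?natrM ?mul1r//; apply/cylinderS.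
by rewrite mul0r mulr0 dirichlet_notin// => /cylinderS[].
Qed.

Variable mu : probability (vilenkin m) R.
Hypothesis mu_product : is_product_measure mu.

Lemma integralC_cst (c : C) : integralC mu (fun=> c) = c.
Proof.
have cstE r : Rintegral mu setT (fun=> r) = r.
  rewrite (Rintegral_cst mu measurableT) [X in fine X](_ : _ = 1%E) ?mulr1//.
  exact: probability_setT.
by rewrite /integralC !cstE; case: c.
Qed.

(** Passing from [dirichlet n] to [dirichlet n.+1] multiplies by a function of
    the coordinate of rank [n] whose mean is one. *)
Lemma integralC_dirichletS n (g : G -> C) : level n g ->
  integralC mu (fun x => g x * (dirichlet n.+1 x)%:C) =
  integralC mu (fun x => g x * (dirichlet n x)%:C).
Proof.
move=> lg; pose h (a : 'Z_(m n)) : C := ((a == 0)%:R * (m n)%:R).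
have -> : (fun x => g x * (dirichlet n.+1 x)%:C) =
    fun x => g x * (dirichlet n x)%:C * h (x n).
  by apply/funext => x; rewrite dirichletS -mulrA !rmorphM/= !rmorph_nat.
rewrite (integralC_indep mu_product)//; last first.
  exact: (level_op2 *%R lg (level_op1 (fun r : R => r%:C) (@level_dirichlet n))).
rewrite (bigD1 0)//= big1 => [|a a0]; last by rewrite /h (negbTE a0) mul0r.
by rewrite addr0 /h eqxx mul1r divff ?mulr1// pnatr_eq0 -lt0n (leq_trans _ (m_ge2 n)).
Qed.

Lemma integralC_dirichlet n : integralC mu (fun x => (dirichlet n x)%:C) = 1.
Proof.
elim: n => [|n ih].
  rewrite -[RHS]integralC_cst; congr integralC; apply/funext => x.
  by rewrite dirichlet_in ?base0.
have := integralC_dirichletS (@level_cst m n C 1).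
have mul1E k : (fun x => 1 * (dirichlet k x)%:C) = fun x => (dirichlet k x)%:C.
  by apply/funext => x; rewrite mul1r.
by rewrite !mul1E ih.
Qed.

(** A frequency below [base m n] is trivial on the cylinder carrying the kernel.
    Any other one has its leading digit at a rank [l >= n], and the coordinate of
    rank [l] is independent of the other factors, so that the nontrivial character
    it carries averages to zero. *)
Lemma fourier_dirichlet n i :
  integralC mu (fun x => (dirichlet n x)%:C * (psi R i x)^*) = (i < base m n)%:R.
Proof.
case: ltnP => [im|ni].
  rewrite -[RHS](integralC_dirichlet n); congr integralC; apply/funext => x.
  have [xn|xn] := pselect (cylinder n origin x).
    by rewrite (psi_cylinder im xn) rmorph1 mulr1.
  by rewrite dirichlet_notin// rmorph0 mul0r.
have i0 : (0 < i)%N by apply: leq_trans ni; exact: base_gt0.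
have [l /andP[li il] dl] := leading_digit m_ge2 i0.
have nl : (n <= l)%N.
  by rewrite leqNgt; apply/negP => /(leq_base m_ge2); move: il ni; lia.
pose g x : C := (dirichlet n x)%:C * (\prod_(k < l) rademacher R k x ^+ digit m i k)^*.
pose h (a : 'Z_(m l)) : C := ((zeta l ^+ a) ^+ digit m i l)^*.
have -> : (fun x => (dirichlet n x)%:C * (psi R i x)^*) = fun x => g x * h (x l).
  apply/funext => x; rewrite (psi_prefix _ il) big_ord_recr/= /g /h -rademacherE.
  by rewrite -mulrA; congr (_ * _); exact: rmorphM.
rewrite (integralC_indep mu_product).
  by rewrite /h sum_rademacher_digit// mul0r mulr0.
apply: (level_op2 *%R).
  exact: (level_op1 (fun r : R => r%:C) (level_le nl (@level_dirichlet n))).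
apply: (level_op1 (@conjc R)); apply: level_big => k _.
exact: (level_op1 (fun z : C => z ^+ digit m i k) (level_rademacher _)).
Qed.

End vilenkin_functions.

(** * A martingale with block-constant Fourier coefficients *)

Section lacunary_martingale.
Variables (R : realType) (m : nat -> nat).
Hypothesis m_ge2 : forall k, (2 <= m k)%N.
Variable mu : probability (vilenkin m) R.
Hypothesis mu_product : is_product_measure mu.
Variable c : nat -> R.
Local Notation G := (vilenkin m).
Local Notation C := R[i].

Definition block_sum (n : nat) (x : G) : R :=
  \sum_(j < n) c j * (dirichlet R j.+1 x - dirichlet R j x).

(** The Fourier series with the constant coefficient [c j] on each block of
    frequencies [base m j, base m j.+1[. *)
Definition block_martingale (n : nat) (x : G) : C := (block_sum n x)%:C.

Lemma block_sumS n x :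
  block_sum n.+1 x = block_sum n x + c n * (dirichlet R n.+1 x - dirichlet R n x).
Proof. by rewrite /block_sum big_ord_recr. Qed.

Lemma level_block_sum n : level n (block_sum n).
Proof.
move=> x y xy; apply: eq_bigr => j _; congr (_ * (_ - _)).
  exact: (level_le (ltn_ord j) (@level_dirichlet R m j.+1) xy).
exact: (level_le (ltnW (ltn_ord j)) (@level_dirichlet R m j) xy).
Qed.

Let levelC n (g : G -> R) : level n g -> level n (fun x => (g x)%:C).
Proof. exact: level_op1. Qed.

Lemma integralC_block_sumS n k (a : G -> C) : (n <= k)%N -> level n a ->
  integralC mu (fun x => a x * (block_sum k.+1 x)%:C) =
  integralC mu (fun x => a x * (block_sum k x)%:C).
Proof.
move=> nk la; have lk := level_le nk la; have lk1 := level_le (leqnSn k) lk.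
pose u x := a x * (block_sum k x)%:C.
pose v j x := a x * (dirichlet R j x)%:C.
have lu : level k.+1 u.
  apply: (level_le (leqnSn k)); apply: (level_op2 *%R lk).
  exact: levelC (@level_block_sum k).
have lv j : (j <= k.+1)%N -> level k.+1 (v j).
  move=> jk; apply: (level_op2 *%R lk1); apply: levelC.
  exact: (level_le jk (@level_dirichlet R m j)).
have lvZ (e : C) j : (j <= k.+1)%N -> level k.+1 (fun x => e * v j x).
  by move=> jk; apply: (level_op1 ( *%R e)); exact: lv.
have -> : (fun x => a x * (block_sum k.+1 x)%:C) =
    fun x => u x + ((c k)%:C * v k.+1 x + - (c k)%:C * v k x).
  apply/funext => x; rewrite block_sumS /u /v.
  move: (block_sum k x) (dirichlet R k.+1 x) (dirichlet R k x) (c k) => s d1 d0 e.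
  by rewrite rmorphD rmorphM rmorphB; ring.
rewrite (integralCD mu_product lu); last first.
  by apply: (level_op2 +%R); apply: lvZ; rewrite ?leqnn ?leqnSn.
rewrite (integralCD mu_product (lvZ _ _ (leqnn _)) (lvZ _ _ (leqnSn k))).
rewrite !(integralCZ mu_product _ (lv _ _)) ?leqnSn//.
by rewrite (integralC_dirichletS m_ge2 mu_product lk) mulNr subrr addr0.
Qed.

Lemma martingale_block_martingale : martingale mu block_martingale.
Proof.
split; last first.
  have -> : (fun n x => complex.Im (block_martingale n x)) = fun _ _ => 0.
    by [].
  split => [n|n|n k A _ _].
  - exact: measurable_cst.
  - exact: (integrable_level mu (@level_cst m n R 0)).
  - by [].
split => [n _ Y mY|n|n k A nk /sigma_cylinders_level lA].
- rewrite setTI; apply/sigma_cylinders_level => x y xy.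
  by rewrite /preimage /= (level_block_sum xy).
- exact: (integrable_level mu (@level_block_sum n)).
pose a x : C := (\1_A x)%:C.
have la : level n a.
  by move=> x y xy; rewrite /a !indicE; congr ((nat_of_bool _)%:R%:C);
    apply/idP/idP; rewrite !inE (lA _ _ xy).
have aE k' : Rintegral mu A (block_sum k') =
    complex.Re (integralC mu (fun x => a x * (block_sum k' x)%:C)).
  rewrite Rintegral_mkcond; apply: eq_Rintegral => x _.
  rewrite /a patchE indicE; case: (x \in A); simpc; by rewrite ?mul1r ?mul0r.
rewrite [LHS]aE [RHS]aE; congr complex.Re.
rewrite -(subnKC nk); elim: (k - n)%N => [|d ih]; first by rewrite addn0.
by rewrite addnS (integralC_block_sumS _ la) ?leq_addr.
Qed.

Lemma integralC_block_martingale k i :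
  integralC mu (fun x => block_martingale k x * (psi R i x)^*) =
  (\sum_(j < k) c j * ((i < base m j.+1)%:R - (i < base m j)%:R))%:C.
Proof.
pose n := maxn i.+1 k.
have lpsi : level n (fun x : G => (psi R i x)^*).
  apply: (level_op1 (@conjc R)); apply: (level_psi R m_ge2).
  by rewrite (leq_trans (base_gt m_ge2 i))// leq_base// (leq_trans _ (leq_maxl _ _)).
pose v j (x : G) := (dirichlet R j x)%:C * (psi R i x)^*.
have lv j : (j <= k)%N -> level n (v j).
  move=> jk; apply: (level_op2 *%R) => //; apply: levelC.
  exact: (level_le (leq_trans jk (leq_maxr _ _)) (@level_dirichlet R m j)).
have lvZ (e : C) j : (j <= k)%N -> level n (fun x => e * v j x).
  by move=> jk; apply: (level_op1 ( *%R e)); exact: lv.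
have -> : (fun x => block_martingale k x * (psi R i x)^*) =
    fun x => \sum_(j < k) ((c j)%:C * v j.+1 x + - (c j)%:C * v j x).
  apply/funext => x; rewrite /block_martingale /block_sum rmorph_sum mulr_suml.
  apply: eq_bigr => j _; rewrite /v.
  move: (dirichlet R j.+1 x) (dirichlet R j x) (c j) => d1 d0 e.
  by rewrite rmorphM rmorphB; ring.
rewrite (integralC_sum mu_product (n := n)) => [|j]; last first.
  by apply: (level_op2 +%R); apply: lvZ => //; exact: ltnW.
rewrite rmorph_sum; apply: eq_bigr => j _; have jk := ltn_ord j.
rewrite (integralCD mu_product (lvZ _ _ jk) (lvZ _ _ (ltnW jk))).
rewrite !(integralCZ mu_product _ (lv _ _)) ?(ltnW jk)//.
rewrite !(fourier_dirichlet m_ge2 mu_product) rmorphM rmorphB !rmorph_nat.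
by ring.
Qed.

Lemma fourier_block_martingale n i : (i < base m n)%N ->
  fourier_coef mu block_martingale i =
  (\sum_(j < n) c j * ((i < base m j.+1)%:R - (i < base m j)%:R))%:C.
Proof.
move=> im; apply: (@cvg_lim (R[i]^o)) => //; apply: cvg_near_cst.
exists n => // k /= nk; apply/eqP; rewrite integralC_block_martingale -(subnKC nk).
elim: (k - n)%N => [|d ih]; first by rewrite addn0.
rewrite addnS big_ord_recr/= [X in (_ + X)%:C](_ : _ = 0) ?addr0//.
by rewrite !(leq_trans im) ?subrr ?mulr0// leq_base// ?leq_addr// -addnS leq_addr.
Qed.

Lemma fourier_block_martingale_block N i : (base m N <= i < base m N.+1)%N ->
  fourier_coef mu block_martingale i = (c N)%:C.
Proof.
move=> /andP[Ni iN]; rewrite (fourier_block_martingale iN) big_ord_recr/=.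
rewrite iN ltnNge Ni subr0 mulr1 big1 ?add0r// => j _.
by rewrite !ltnNge !(leq_trans _ Ni)/= ?subrr ?mulr0// leq_base// ltnW.
Qed.

Hypothesis c_ge0 : forall j, 0 <= c j.

(** An upper bound for the sum of the absolute values of the Fourier coefficients
    of index smaller than [base m N]. *)
Definition block_bound N : R := \sum_(j < N) c j * (base m j.+1)%:R.

Lemma block_bound_ge0 N : 0 <= block_bound N.
Proof. by apply: sumr_ge0 => j _; rewrite mulr_ge0. Qed.

Lemma fourier_block_martingale_le n i : (i < base m n)%N ->
  `|fourier_coef mu block_martingale i| <=
  (\sum_(j < n) c j * (i < base m j.+1)%:R)%:C.
Proof.
move=> im; rewrite (fourier_block_martingale im) rmorph_sum/=.
rewrite (le_trans (ler_norm_sum _ _ _))// rmorph_sum ler_sum// => j _.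
rewrite normc_def/= expr0n/= addr0 sqrtr_sqr lecR normrM (ger0_norm (c_ge0 j)).
rewrite ler_wpM2l//.
case: ltnP => [_|ji].
  by case: ltnP => _; rewrite ?subrr ?subr0 ?normr0 ?normr1 ?ler01.
by rewrite ltnNge (leq_trans (leq_base m_ge2 (leqnSn j)) ji) subrr normr0.
Qed.

Lemma sum_ltn_le n M : (\sum_(i < n) (i < M : nat) <= M)%N.
Proof.
suff -> : (\sum_(i < n) (i < M : nat) = minn n M)%N by rewrite geq_minr.
by elim: n => [|n ih]; rewrite ?big_ord0 ?min0n// big_ord_recr/= ih; lia.
Qed.

Lemma partial_sum_le N k x : (k <= base m N)%N ->
  `|partial_sum mu block_martingale k x| <= (block_bound N)%:C.
Proof.
move=> kM; apply: le_trans (ler_norm_sum _ _ _) _.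
apply: (@le_trans _ _ (\sum_(i < k) (\sum_(j < N) c j * (i < base m j.+1)%:R)%:C)).
  apply: ler_sum => i _; rewrite normrM normc_psi mulr1.
  exact: fourier_block_martingale_le (leq_trans (ltn_ord i) kM).
rewrite -rmorph_sum lecR exchange_big/= ler_sum// => j _.
by rewrite -mulr_sumr ler_wpM2l// -natr_sum ler_nat sum_ltn_le.
Qed.

(** Inside the block of rank [N] all the terms are equal near the origin, by
    [psi_base_add], so that the partial sums grow linearly. *)
Lemma partial_sum_block N t s x : (t <= N)%N -> (s <= base m t)%N ->
  cylinder t (@origin m) x ->
  partial_sum mu block_martingale (base m N + s) x =
  partial_sum mu block_martingale (base m N) x +
  (c N * s%:R)%:C * rademacher R N x.
Proof.
move=> tN + xt; elim: s => [|s ih] st.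
  by rewrite addn0 mulr0 rmorph0 mul0r addr0.
rewrite addnS {1}/partial_sum big_ord_recr/= -/(partial_sum _ _ _ _) ih 1?ltnW//.
rewrite (psi_base_add R m_ge2 tN st xt) (fourier_block_martingale_block (N := N)).
  by rewrite -addrA -mulrDl -rmorphD/= -natr1 mulrDr mulr1.
rewrite leq_addr/=; apply: leq_trans (leq_double_base m_ge2 N).
by rewrite mul2n -addnn ltn_add2l (leq_trans st)// leq_base.
Qed.

End lacunary_martingale.

(** * Lower bound for the logarithmic means near the origin *)

Section norlund_lower_bound.
Variables (R : realType) (m : nat -> nat) (b : nat).
Hypothesis m_ge2 : forall k, (2 <= m k)%N.
Hypothesis m_le : forall k, (m k <= b)%N.
Local Notation G := (vilenkin m).
Local Notation C := R[i].

Lemma norm_normc (z : C) : `|z| = (Normc.normc z)%:C.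
Proof. by []. Qed.

Lemma norm_real_complex (r : R) : `|r%:C| = `|r|%:C.
Proof. by rewrite normc_def/= expr0n/= addr0 sqrtr_sqr. Qed.

Lemma log_weightE n : log_weight R n = (harmonic_sum R n)%:C.
Proof.
rewrite /log_weight /harmonic_sum rmorph_sum; apply: eq_bigr => k _.
by rewrite fmorphV rmorph_nat.
Qed.

Lemma sum_norlund_weights n :
  \sum_(1 <= k < n) (n - k)%:R^-1 <= harmonic_sum R n.
Proof.
have -> : \sum_(1 <= k < n) (n - k)%:R^-1 = \sum_(1 <= k < n) k%:R^-1 :> R.
  by rewrite big_nat_rev/=; apply: eq_big_nat => k kn; congr (_%:R^-1); lia.
have [n0|n0] := posnP n; first by rewrite n0 /harmonic_sum !big_geq.
by rewrite /harmonic_sum big_nat_recr//= lerDl invr_ge0.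
Qed.

(** After the change of index [i = M + T - k] the terms with [i <= T] are
    [T / i - 1]: the weights turn the linear growth of the partial sums after the
    index [M] into an extra logarithmic factor. *)
Lemma norlund_kernel_at_origin M T : (0 < M)%N ->
  T%:R * (harmonic_sum R T - 1) <=
  \sum_(1 <= k < M + T) (k - M)%:R / (M + T - k)%:R.
Proof.
move=> M0; rewrite big_nat_rev/=.
have -> : \sum_(1 <= i < M + T) (1 + (M + T) - i.+1 - M)%:R /
    (M + T - (1 + (M + T) - i.+1))%:R = \sum_(1 <= i < M + T) (T - i)%:R / i%:R :> R.
  by apply: eq_big_nat => i iMT; congr (_%:R / _%:R); lia.
rewrite (@big_cat_nat _ _ _ T.+1)//=; last by lia.
rewrite -[leLHS]addr0 lerD//; last by apply: sumr_ge0 => i _; rewrite divr_ge0.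
rewrite mulrBr mulr1 /harmonic_sum mulr_sumr lerBlDr.
have -> : T%:R = \sum_(1 <= k < T.+1) 1 :> R by rewrite big_const_nat iter_addr_0 subn1.
rewrite -big_split/= big_nat_cond [leRHS]big_nat_cond ler_sum// => i /andP[/andP[i1 iT] _].
rewrite -[X in _ + X](@divff _ i%:R) ?pnatr_eq0 -?lt0n// -mulrDl ler_wpM2r ?invr_ge0//.
by rewrite big_const_nat iter_addr_0 subn1 -natrD subnK.
Qed.

Variable mu : probability (vilenkin m) R.
Hypothesis mu_product : is_product_measure mu.
Variable c : nat -> R.
Hypothesis c_ge0 : forall j, 0 <= c j.
Local Notation f := (block_martingale c).

(** The means of order [base m N + base m t] see the block of rank [N] through
    the logarithmic kernel of order [base m t]; the earlier blocks contribute
    at most [block_bound c N]. *)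
Lemma norlund_log_mean_lower N t (x : G) : (t <= N)%N -> cylinder t (@origin m) x ->
  c N * ((base m t)%:R * (t%:R / 2)) / (1 + N.+1%:R * b%:R) - block_bound m c N <=
  Normc.normc (norlund_log_mean mu f (base m N + base m t) x).
Proof.
move=> tN xt; set M := base m N; set T := base m t; set n := (M + T)%N.
have M0 : (0 < M)%N by exact: base_gt0.
have n0 : (0 < n)%N by rewrite addn_gt0 M0.
have H0 : 0 < harmonic_sum R n by exact: harmonic_sum_gt0.
set B := block_bound m c N; have B0 : 0 <= B by exact: block_bound_ge0.
pose Q : R := \sum_(1 <= k < n) (k - M)%:R / (n - k)%:R.
pose E k := partial_sum mu f (minn k M) x.
have En k : `|E k| <= B%:C.
  by apply: (partial_sum_le m_ge2 mu_product c_ge0); exact: geq_minr.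
pose Z := \sum_(1 <= k < n) partial_sum mu f k x / (n - k)%:R.
have ZE : Z = \sum_(1 <= k < n) E k / (n - k)%:R + (c N * Q)%:C * rademacher R N x.
  rewrite /Q mulr_sumr rmorph_sum mulr_suml -big_split/=.
  apply: eq_big_nat => k /andP[k1 kn].
  have -> : partial_sum mu f k x = E k + (c N * (k - M)%:R)%:C * rademacher R N x.
    rewrite /E; case: (leqP k M) => [kM|Mk].
      by rewrite (eqP kM) mulr0 rmorph0 mul0r addr0.
    rewrite -(partial_sum_block m_ge2 mu_product _ tN _ xt); last by rewrite -/T; lia.
    by rewrite -/M subnKC// ltnW.
  rewrite mulrDl; congr (_ + _); rewrite mulrA !rmorphM/= fmorphV !rmorph_nat.
  by rewrite mulrAC.
have EB : `|\sum_(1 <= k < n) E k / (n - k)%:R| <= (B * harmonic_sum R n)%:C.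
  apply: le_trans (ler_norm_sum _ _ _) _.
  apply: (@le_trans _ _ (B * \sum_(1 <= k < n) (n - k)%:R^-1)%:C); last first.
    by rewrite lecR ler_wpM2l// sum_norlund_weights.
  rewrite mulr_sumr rmorph_sum ler_sum// => k _.
  rewrite normrM normfV normr_nat rmorphM/= fmorphV rmorph_nat.
  by rewrite ler_wpM2r ?invr_ge0.
have Q0 : T%:R * (t%:R / 2) <= Q.
  apply: le_trans (norlund_kernel_at_origin T M0); rewrite ler_wpM2l//.
  by rewrite lerBrDl; exact: harmonic_base_ge.
(* the error terms are weighted by at most the normalising factor *)
have ZQ : c N * Q - B * harmonic_sum R n <= Normc.normc Z.
  rewrite lerBlDr -lecR rmorphD/= -norm_normc.
  have -> : (c N * Q)%:C = `|(c N * Q)%:C * rademacher R N x|.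
    rewrite normrM normc_rademacher mulr1 norm_real_complex ger0_norm//.
    by rewrite mulr_ge0// (le_trans _ Q0)// mulr_ge0.
  have -> : (c N * Q)%:C * rademacher R N x = Z - \sum_(1 <= k < n) E k / (n - k)%:R.
    by rewrite ZE addrAC subrr add0r.
  by apply: le_trans (ler_normB _ _) _; rewrite lerD2l.
have -> : Normc.normc (norlund_log_mean mu f n x) = Normc.normc Z / harmonic_sum R n.
  apply: complexI; rewrite -norm_normc /norlund_log_mean -/Z log_weightE normrM normfV.
  rewrite norm_real_complex (ger0_norm (ltW H0)) norm_normc rmorphM/= fmorphV.
  by rewrite mulrC.
apply: (@le_trans _ _ (c N * Q / harmonic_sum R n - B)); last first.
  rewrite ler_pdivlMr// mulrBl mulfVK ?gt_eqF//.
rewrite lerD2r; apply: ler_pM.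
- by rewrite !mulr_ge0.
- by rewrite invr_ge0 addr_ge0// mulr_ge0.
- by rewrite ler_wpM2l.
have D0 : 0 < 1 + N.+1%:R * b%:R :> R by rewrite ltr_pwDl// mulr_ge0.
rewrite lef_pV2 ?posrE//.
apply: le_trans (harmonic_base_le R m_ge2 m_le N.+1).
have nM : (n <= base m N.+1)%N.
  apply: leq_trans (leq_double_base m_ge2 N); rewrite mul2n -addnn leq_add2l.
  exact: leq_base.
by rewrite -(subnKC nM) harmonic_sum_le.
Qed.

(** Restricting to ranks [t] between half of the rank of the block and that rank
    makes the logarithms of the numerator and of the denominator comparable. *)
Lemma norlund_log_maximal_lower K t (x : G) : (0 < K)%N -> (K <= t < 2 * K)%N ->
  cylinder t (@origin m) x ->
  (((8 * b%:R)^-1 * (c (2 * K)%N * (base m t)%:R) - block_bound m c (2 * K))%R%:E <=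
    norlund_log_maximal mu f x)%E.
Proof.
move=> K0 /andP[Kt tK] xt.
apply: (@le_trans _ _
    (Normc.normc (norlund_log_mean mu f (base m (2 * K) + base m t) x))%:E); last first.
  apply: ereal_sup_ubound; exists (base m (2 * K) + base m t)%N => //=.
  by rewrite addn_gt0 base_gt0.
rewrite lee_fin; apply: le_trans (norlund_log_mean_lower (ltnW tK) xt).
rewrite lerD2r mulrC (mulrA (c _)) -[leRHS]mulrA ler_wpM2l ?mulr_ge0//.
have b1 : 1 <= b%:R :> R by rewrite ler1n (leq_trans _ (m_le 0))// ltnW.
have K1 : 1 <= K%:R :> R by rewrite ler1n.
have Kt' : K%:R <= t%:R :> R by rewrite ler_nat.
rewrite ler_pdivlMr; last by rewrite ltr_pwDl// mulr_ge0.
rewrite ler_pdivrMl; last by rewrite mulr_gt0// (lt_le_trans _ b1).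
by rewrite -natr1 natrM; nra.
Qed.

End norlund_lower_bound.

(** * The Hardy quasinorm for exponents at most one *)

Section power_inequalities.
Variables (R : realType) (p : R).
Hypotheses (p_gt0 : 0 < p) (p_le1 : p <= 1).

(** Each ratio [u] of a summand to the sum lies in [0, 1], where [u <= u ^ p]. *)
Lemma powR_subadditive (a b : R) : 0 <= a -> 0 <= b ->
  (a + b) `^ p <= a `^ p + b `^ p.
Proof.
move=> a0 b0; have [s0|s0] := leP (a + b) 0.
  have -> : a + b = 0 by apply/eqP; rewrite eq_le s0 addr_ge0.
  by rewrite powR0 ?gt_eqF// addr_ge0// powR_ge0.
have le_ratio u : 0 <= u -> u <= a + b -> u / (a + b) * (a + b) `^ p <= u `^ p.
  move=> u0 us; have [->|un0] := eqVneq u 0; first by rewrite !mul0r powR_ge0.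
  have up : 0 < u by rewrite lt0r un0.
  rewrite -[in leRHS](divfK (lt0r_neq0 s0) u) powRM ?divr_ge0 ?(ltW s0)//.
  rewrite ler_wpM2r ?powR_ge0// ger1_powR// divr_gt0//=.
  by rewrite ler_pdivrMr// mul1r.
rewrite -[leLHS]mul1r -(divff (lt0r_neq0 s0)) mulrDl mulrDl.
by apply: lerD; apply: le_ratio; rewrite ?lerDl ?lerDr.
Qed.

Lemma powR_sum_le n (y : nat -> R) : (forall j, 0 <= y j) ->
  (\sum_(j < n) y j) `^ p <= \sum_(j < n) y j `^ p.
Proof.
move=> y0; elim: n => [|n ih]; first by rewrite !big_ord0 powR0 ?gt_eqF.
rewrite !big_ord_recr/=; apply: le_trans (powR_subadditive _ (y0 n)) _.
  exact: sumr_ge0.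
by rewrite lerD2r.
Qed.

Lemma powRK_inv (a : R) : 0 <= a -> (a `^ p^-1) `^ p = a.
Proof. by move=> a0; rewrite -powRrM mulVf ?gt_eqF// powRr1. Qed.

Lemma ge1_invp : 1 <= p^-1.
Proof. by rewrite invf_ge1. Qed.

Context d (T : measurableType d).
Variable mu : {measure set T -> \bar R}.

(** The integral of a nonnegative function is the supremum of the integrals of the
    simple functions below it, so that it is monotone on arbitrary functions. *)
Lemma ge0_integral_le (f g : T -> \bar R) :
  (forall x, 0 <= f x)%E -> (forall x, f x <= g x)%E ->
  (\int[mu]_x f x <= \int[mu]_x g x)%E.
Proof.
move=> f0 fg; rewrite !ge0_integralTE//; last by move=> x; exact: le_trans (fg x).
apply: ub_ereal_sup => _ [h hf <-]; apply: ereal_sup_ubound; exists h => // x.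
exact: le_trans (hf x) (fg x).
Qed.

Lemma Lnorm_lty (f g : T -> \bar R) :
  (forall x, `|f x| `^ p <= g x)%E -> (\int[mu]_x g x < +oo)%E ->
  (Lnorm mu p%:E f < +oo)%E.
Proof.
move=> fg gy; rewrite unlock; apply: poweR_lty; apply: le_lt_trans gy.
by apply: ge0_integral_le => // x; exact: poweR_ge0.
Qed.

Lemma Lnorm_eqy (f : T -> \bar R) :
  (forall A : nat, (A%:R%:E <= \int[mu]_x (`|f x| `^ p))%E) ->
  Lnorm mu p%:E f = +oo%E.
Proof.
move=> fA; rewrite unlock; apply: eqy_poweR; first by rewrite invr_gt0.
apply/eqyP => A A0; apply: le_trans (fA (Num.truncn A).+1).
by rewrite lee_fin ltW// truncnS_gt.
Qed.

End power_inequalities.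

Section hardy_bound.
Variables (R : realType) (m : nat -> nat) (p : R).
Hypothesis m_ge2 : forall k, (2 <= m k)%N.
Hypotheses (p_gt0 : 0 < p) (p_le1 : p <= 1).
Variable mu : probability (vilenkin m) R.
Hypothesis mu_product : is_product_measure mu.
Variable c : nat -> R.
Hypothesis c_ge0 : forall j, 0 <= c j.
Local Notation G := (vilenkin m).

Lemma dirichlet_diff_le j (x : G) :
  `|dirichlet R j.+1 x - dirichlet R j x| <=
  (base m j.+1)%:R * \1_(cylinder j (@origin m)) x.
Proof.
have Mj : (base m j)%:R <= (base m j.+1)%:R :> R by rewrite ler_nat leq_base.
have [xj|xj] := pselect (cylinder j (@origin m) x); last first.
  rewrite !dirichlet_notin ?subrr ?normr0 ?mulr_ge0//.
  by move=> /cylinderS[].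
rewrite indicE mem_set// mulr1 (dirichlet_in _ xj).
have [xj1|xj1] := pselect (cylinder j.+1 (@origin m) x).
  by rewrite dirichlet_in// ger0_norm ?subr_ge0// gerBl.
by rewrite dirichlet_notin// sub0r normrN ger0_norm.
Qed.

Lemma block_martingale_powR n (x : G) :
  Normc.normc (block_martingale c n x) `^ p <=
  \sum_(j < n) (c j * (base m j.+1)%:R) `^ p * \1_(cylinder j (@origin m)) x.
Proof.
have -> : Normc.normc (block_martingale c n x) = `|block_sum c n x|.
  by apply: complexI; rewrite -norm_normc norm_real_complex.
pose y j := c j * (base m j.+1)%:R * \1_(cylinder j (@origin m)) x.
have y0 j : 0 <= y j by rewrite !mulr_ge0.
apply: (@le_trans _ _ ((\sum_(j < n) y j) `^ p)).
  apply: ge0_ler_powR; rewrite ?nnegrE ?sumr_ge0 ?(ltW p_gt0)//.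
  apply: le_trans (ler_norm_sum _ _ _) _; apply: ler_sum => j _.
  rewrite normrM (ger0_norm (c_ge0 j)) /y -mulrA ler_wpM2l//.
  exact: dirichlet_diff_le.
apply: le_trans (powR_sum_le p_gt0 p_le1 _ y0) _; apply: ler_sum => j _.
rewrite /y indicE; case: (_ \in _); first by rewrite !mulr1.
by rewrite !mulr0 powR0 ?gt_eqF.
Qed.

(** For [p <= 1] subadditivity lets the differences of the martingale be treated
    one by one: the [j]-th one is at most [c j * base m j.+1], on a cylinder of
    measure [1 / base m j]. *)
Lemma hardy_norm_block_martingale (A : R) :
  (forall n, \sum_(j < n) (c j * (base m j.+1)%:R) `^ p / (base m j)%:R <= A) ->
  (hardy_norm mu p (block_martingale c) < +oo)%E.
Proof.
move=> cA; pose a j := (c j * (base m j.+1)%:R) `^ p.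
have a0 j : 0 <= a j by exact: powR_ge0.
pose g j (x : G) := (a j * \1_(cylinder j (@origin m)) x)%:E.
have g0 j x : (0 <= g j x)%E by rewrite lee_fin mulr_ge0.
have mI j : measurable (cylinder j (@origin m)) by exact: measurable_cylinder.
have mg j : measurable_fun setT (g j).
  by apply/measurable_EFinP; apply: measurable_funM => //; exact: measurable_indic.
apply: (Lnorm_lty (g := fun x => \sum_(0 <= j <oo) g j x)%E) => [x|].
  set S := (\sum_(0 <= j <oo) g j x)%E.
  have S0 : (0 <= S)%E by apply: nneseries_ge0.
  have fS n : ((Normc.normc (block_martingale c n x))%:E <= S `^ p^-1)%E.
    have : (((Normc.normc (block_martingale c n x)) `^ p)%:E <= S)%E.
      apply: le_trans (nneseries_lim_ge n _) => //.
      by rewrite big_mkord sumEFin lee_fin; exact: block_martingale_powR.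
    move=> /(gt0_ler_poweR (r := p^-1)).
    rewrite invr_ge0 (ltW p_gt0) => /(_ isT); rewrite !in_itv/= !leey !andbT.
    rewrite lee_fin powR_ge0 => /(_ isT S0); rewrite -powRrM.
    by rewrite mulfV ?gt_eqF// powRr1// sqrtr_ge0.
  have f0 : (0 <= maximal_function (block_martingale c) x)%E.
    apply: (@le_trans _ _ (Normc.normc (block_martingale c 0 x))%:E).
      by rewrite lee_fin sqrtr_ge0.
    by apply: ereal_sup_ubound; exists 0%N.
  have fS' : (maximal_function (block_martingale c) x <= S `^ p^-1)%E.
    by apply: ub_ereal_sup => _ [n _ <-]; exact: fS.
  rewrite gee0_abs//.
  have -> : S = ((S `^ p^-1) `^ p)%E by rewrite -poweRrM mulVf ?gt_eqF// poweRe1.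
  by apply: gt0_ler_poweR; rewrite ?(ltW p_gt0)// in_itv/= leey ?f0 ?poweR_ge0.
rewrite integral_nneseries//.
apply: (@le_lt_trans _ _ A%:E); last exact: ltry.
apply: lime_le; first by apply: is_cvg_nneseries => n _ _; exact: integral_ge0.
apply: nearW => n; rewrite big_mkord.
apply: le_trans (_ : ((\sum_(j < n) a j / (base m j)%:R)%:E <= _)%E); last first.
  by rewrite lee_fin; exact: cA.
rewrite -sumEFin; apply: lee_sum => j _; rewrite /g.
under eq_integral do rewrite EFinM.
rewrite ge0_integralZl_EFin//; last exact/measurable_EFinP/measurable_indic.
by rewrite integral_indic// setIT [X in (_ * X)%E](measure_cylinder mu_product) -EFinM.
Qed.

End hardy_bound.

(** * Divergence of the maximal operator *)

Section divergence.
Variables (R : realType) (m : nat -> nat) (b : nat) (p : R).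
Hypothesis m_ge2 : forall k, (2 <= m k)%N.
Hypothesis m_le : forall k, (m k <= b)%N.
Hypotheses (p_gt0 : 0 < p) (p_le1 : p <= 1).
Local Notation G := (vilenkin m).
Local Notation M j := ((base m j)%:R : R).

Let M_gt0 j : 0 < M j.
Proof. by rewrite natr_base_gt0. Qed.

(** With this normalisation [v j] is, up to a constant, the [p]-th power of the
    quasinorm of the [j]-th difference of the martingale. *)
Definition block_coef (v : nat -> R) (j : nat) : R := (v j * M j) `^ p^-1 / M j.

Lemma block_coef_ge0 v j : 0 <= block_coef v j.
Proof. by rewrite divr_ge0// powR_ge0. Qed.

Lemma block_coef_hardy v j : 0 <= v j ->
  (block_coef v j * (base m j.+1)%:R) `^ p / M j <= b%:R * v j.
Proof.
move=> v0; have vM : 0 <= v j * M j by rewrite mulr_ge0.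
have -> : block_coef v j * (base m j.+1)%:R = (v j * M j) `^ p^-1 * (m j)%:R.
  by rewrite /block_coef baseS natrM mulrA divfK// gt_eqF.
rewrite powRM ?powR_ge0// powRK_inv// ler_pdivrMr// mulrC mulrA.
rewrite ler_wpM2r// ler_wpM2r// (@le_trans _ _ (m j)%:R) ?ler_nat//.
by rewrite ler1_powR// ler1n (leq_trans _ (m_ge2 j)).
Qed.

(** The ratio [M t / M N] is at most one and [1 <= 1 / p], so that the power [1 / p]
    of this ratio is at most the ratio itself. *)
Lemma block_coef_lower v N t : 0 <= v N -> (t <= N)%N ->
  (v N * M t) `^ p^-1 <= block_coef v N * M t.
Proof.
move=> v0 tN; have q1 : M t / M N <= 1.
  by rewrite ler_pdivrMr// mul1r ler_nat leq_base.
have -> : v N * M t = (v N * M N) * (M t / M N).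
  by rewrite -mulrA; congr (_ * _); rewrite mulrCA divff ?mulr1// gt_eqF.
rewrite powRM ?mulr_ge0 ?divr_ge0// /block_coef -mulrA ler_wpM2l ?powR_ge0//.
rewrite [leRHS]mulrC; apply: ge1r_powR; last exact: ge1_invp.
by rewrite divr_gt0.
Qed.

Variable mu : probability (vilenkin m) R.
Hypothesis mu_product : is_product_measure mu.

Definition annulus t : set G := cylinder t (@origin m) `\` cylinder t.+1 (@origin m).

Lemma annulus_disjoint t t' x : annulus t x -> annulus t' x -> t = t'.
Proof.
move=> [It It1] [It' It1']; have [tt|tt|//] := ltngtP t t'.
  by case: It1 => k kt; apply: It'; exact: leq_trans tt.
by case: It1' => k kt; apply: It; exact: leq_trans tt.
Qed.

Lemma measurable_annulus t : measurable (annulus t).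
Proof. by apply: measurableD; exact: measurable_cylinder. Qed.

Lemma measure_annulus_ge t : (((2 * M t)^-1)%:E <= mu (annulus t))%E.
Proof.
rewrite measureD; [|exact: measurable_cylinder|exact: measurable_cylinder|]; last first.
  by rewrite [X in (X < _)%E](measure_cylinder mu_product) ltry.
rewrite setIidr; last by move=> x /cylinderS[].
rewrite [X in (_ <= X - _)%E](measure_cylinder mu_product).
rewrite [X in (_ <= _ - X)%E](measure_cylinder mu_product) -EFinB lee_fin.
have h : (M t.+1)^-1 <= (2 * M t)^-1.
  by rewrite lef_pV2 ?posrE ?mulr_gt0// -natrM ler_nat leq_double_base.
rewrite lerBrDl; apply: le_trans (lerD h (lexx _)) _.
by rewrite invfM; lra.
Qed.

Variable v : nat -> R.
Hypothesis v_ge0 : forall j, 0 <= v j.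
Local Notation c := (block_coef v).
Local Notation f := (block_martingale c).

(** The bound on [block_bound] makes the error at most half of the main term: since
    [1 <= v * K <= v * M t], the power [1 / p] of [v * M t] is at least [v * K]. *)
Lemma norlund_log_maximal_annulus K t (x : G) : (0 < K)%N -> (K <= t < 2 * K)%N ->
  1 <= v (2 * K)%N * K%:R ->
  2 * block_bound m c (2 * K) <= (8 * b%:R)^-1 * (v (2 * K)%N * K%:R) ->
  cylinder t (@origin m) x ->
  (((16 * b%:R)^-1 * (v (2 * K)%N * M t) `^ p^-1)%R%:E <=
   norlund_log_maximal mu f x)%E.
Proof.
move=> K0 KtK vK vB xt; have /andP[Kt tK] := KtK.
apply: le_trans
  (norlund_log_maximal_lower m_ge2 m_le mu_product (block_coef_ge0 v) K0 KtK xt).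
rewrite lee_fin; set N := (2 * K)%N in vK vB *; set Y := _ `^ _.
set B := block_bound _ _ _ in vB *.
have b0 : 0 < b%:R :> R by rewrite ltr0n (leq_trans _ (m_le 0))// (leq_trans _ (m_ge2 0)).
have cY : Y <= c N * M t by apply: block_coef_lower => //; exact: ltnW.
have KM : v N * K%:R <= v N * M t.
  by rewrite ler_wpM2l// ler_nat (leq_trans Kt)// ltnW// base_gt.
have vKY : v N * K%:R <= Y.
  apply: (le_trans KM); apply: le1r_powR; last exact: ge1_invp.
  exact: le_trans vK KM.
have -> : (16 * b%:R)^-1 = (8 * b%:R)^-1 / 2 :> R by rewrite -invfM; congr _^-1; ring.
have k0 : 0 < (8 * b%:R)^-1 :> R by rewrite invr_gt0 mulr_gt0.
move: k0 vB; set k := (8 * b%:R)^-1 => k0 vB.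
have h1 : k * (v N * K%:R) <= k * Y by rewrite ler_wpM2l// ltW.
have h2 : k * Y <= k * (c N * M t) by rewrite ler_wpM2l// ltW.
lra.
Qed.

(** On the annulus of rank [t] the [p]-th power of the maximal operator is at
    least a multiple of [v * M t], and the measure of this annulus is at least
    [1 / (2 M t)]. Hence a single difference of the martingale gives the same
    lower bound on each of the [K] annuli of rank [K, ..., 2 K - 1]. *)
Lemma norlund_log_maximal_integral K : (0 < K)%N ->
  1 <= v (2 * K)%N * K%:R ->
  2 * block_bound m c (2 * K) <= (8 * b%:R)^-1 * (v (2 * K)%N * K%:R) ->
  (((16 * b%:R)^-1 `^ p * (v (2 * K)%N * K%:R / 2))%R%:E <=
   \int[mu]_x (`|norlund_log_maximal mu f x| `^ p))%E.
Proof.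
move=> K0 vK vB; set N := (2 * K)%N in vK vB *.
pose w : R := (16 * b%:R)^-1 `^ p * v N.
have w0 : 0 <= w by rewrite mulr_ge0// powR_ge0.
pose h (i : 'I_K) (x : G) := ((w * M (K + i)) * \1_(annulus (K + i)) x)%:E.
have h0 i x : (0 <= h i x)%E by rewrite lee_fin !mulr_ge0.
have mh i : measurable_fun setT (h i).
  apply/measurable_EFinP; apply: measurable_funM => //; apply: measurable_indic.
  exact: measurable_annulus.
apply: (@le_trans _ _ (\int[mu]_x (\sum_(i < K) h i x))%E); last first.
  apply: ge0_integral_le => x; first exact: sume_ge0.
  have [[i xi]|no] := pselect (exists i : 'I_K, annulus (K + i) x); last first.
    rewrite big1 ?poweR_ge0// => i _; rewrite /h indicE memNset ?mulr0//.
    by move=> xi; apply: no; exists i.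
  rewrite (bigD1 i)//= big1 ?adde0 => [|j ji]; last first.
    rewrite /h indicE memNset ?mulr0// => xj; move/eqP: ji; apply.
    by apply: val_inj; exact: addnI (annulus_disjoint xj xi).
  rewrite /h indicE mem_set// mulr1.
  have tK : (K <= K + i < 2 * K)%N by rewrite leq_addr mul2n -addnn ltn_add2l ltn_ord.
  have := norlund_log_maximal_annulus K0 tK vK vB xi.1; set L := norlund_log_maximal _ _ _.
  set Y := (v (2 * K)%N * _) `^ _ => YL.
  have Y0 : 0 <= (16 * b%:R)^-1 * Y by rewrite mulr_ge0 ?powR_ge0.
  have -> : (w * M (K + i))%:E = (((16 * b%:R)^-1 * Y)%:E `^ p)%E.
    by rewrite poweR_EFin powRM ?powR_ge0// /Y powRK_inv ?mulr_ge0// mulrA.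
  apply: gt0_ler_poweR; rewrite ?(ltW p_gt0)// ?in_itv/= ?leey ?andbT ?lee_fin//.
  exact: le_trans YL (lee_abs _).
rewrite ge0_integral_sum//.
have -> : (16 * b%:R)^-1 `^ p * (v N * K%:R / 2) = \sum_(i < K) w / 2.
  by rewrite sumr_const card_ord -[RHS]mulr_natr /w; ring.
rewrite -sumEFin; apply: lee_sum => i _; rewrite /h.
under eq_integral do rewrite EFinM.
have mA := measurable_annulus (K + i).
rewrite ge0_integralZl_EFin//; last 2 first.
- exact/measurable_EFinP/measurable_indic.
- by rewrite mulr_ge0.
rewrite integral_indic// setIT.
apply: le_trans (lee_wpmul2l _ (measure_annulus_ge (K + i))); last first.
  by rewrite lee_fin mulr_ge0.
rewrite -EFinM lee_fin; suff -> : w * M (K + i) * (2 * M (K + i))^-1 = w / 2 by [].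
by field; rewrite gt_eqF.
Qed.

End divergence.

Section block_bound_sparse.
Variables (R : realType) (m : nat -> nat) (p : R).
Hypotheses (p_gt0 : 0 < p).

(** The contribution of the blocks before a gap is controlled by the position of
    the gap alone, so that the next block can be chosen accordingly. *)
Lemma block_bound_sparse (v : nat -> R) (n N : nat) :
  (forall j, 0 <= v j <= 2) -> (n <= N)%N ->
  (forall j, (n <= j < N)%N -> v j = 0) ->
  block_bound m (block_coef m p v) N <= block_bound m (block_coef m p (fun=> 2)) n.
Proof.
move=> v02 nN vgap; rewrite /block_bound -!(big_mkord xpredT
  (fun j => block_coef m p _ j * (base m j.+1)%:R)).
rewrite (@big_cat_nat _ _ _ n)//= [X in _ + X]big_nat_cond [X in _ + X]big1 ?addr0.
  apply: ler_sum => j _; rewrite ler_wpM2r// ler_wpM2r ?invr_ge0//.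
  have /andP[v0 v2] := v02 j.
  by rewrite ge0_ler_powR ?invr_ge0 ?(ltW p_gt0) ?nnegrE ?mulr_ge0// ler_wpM2r.
move=> j; rewrite andbT => /vgap vj.
by rewrite /block_coef vj mul0r powR0 ?mul0r// invr_neq0// gt_eqF.
Qed.

End block_bound_sparse.

Theorem theorem3 (R : realType) (m : nat -> nat)
    (m_ge2 : forall k, (2 <= m k)%N)
    (m_bounded : exists N : nat, forall k, (m k <= N)%N)
    (mu : probability (vilenkin m) R) (mu_product : is_product_measure mu)
    (p : R) (p_gt0 : 0 < p) (p_le1 : p <= 1) :
  exists f : nat -> vilenkin m -> R[i],
    in_hardy mu p f /\
    Lnorm mu p%:E (norlund_log_maximal mu f) = +oo%E.
Proof.
have [b m_le] := m_bounded.
pose B n : R := block_bound m (block_coef m p (fun=> 2)) n.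
have B0 n : 0 <= B n by apply: block_bound_ge0 => j; exact: block_coef_ge0.
have b0 : 0 < b%:R :> R by rewrite ltr0n (leq_trans _ (m_le 0))// (leq_trans _ (m_ge2 0)).
have [v [v_ge0 v_sum v_gap]] := sparse_weights (fun n => 1 + 16 * b%:R * B n).
have v_le2 j : v j <= 2.
  by apply: le_trans (v_sum j.+1); rewrite big_ord_recr/= lerDr sumr_ge0.
have c_ge0 := block_coef_ge0 m p v.
exists (block_martingale (block_coef m p v)); split.
  split; first exact: martingale_block_martingale.
  apply: (hardy_norm_block_martingale m_ge2 p_gt0 p_le1 mu_product c_ge0 (A := b%:R * 2)).
  move=> n; apply: (@le_trans _ _ (b%:R * \sum_(j < n) v j)); last by rewrite ler_wpM2l.
  by rewrite mulr_sumr; apply: ler_sum => j _; exact: block_coef_hardy.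
apply: (Lnorm_eqy p_gt0) => A.
(* [k / 2] is the constant of [norlund_log_maximal_integral] *)
pose k : R := (16 * b%:R)^-1 `^ p.
have k0 : 0 < k by rewrite powR_gt0// invr_gt0 mulr_gt0.
have [n [K [nN K0 vn vK]]] := v_gap (Num.truncn (2 * A%:R / k)).+1.
have BN : block_bound m (block_coef m p v) (2 * K) <= B n.
  by apply: block_bound_sparse => // j; rewrite v_ge0 v_le2.
have Bn := B0 n; have bB : 0 <= b%:R * B n by rewrite mulr_ge0// ltW.
have C0 : 2 * A%:R / k < (Num.truncn (2 * A%:R / k)).+1%:R by exact: truncnS_gt.
have A0 : 0 <= 2 * A%:R / k by rewrite divr_ge0 ?mulr_ge0// ltW.
apply: le_trans (norlund_log_maximal_integral m_ge2 m_le p_gt0 p_le1 mu_product v_ge0 K0 _ _).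
- rewrite lee_fin -/k.
  have : 2 * A%:R / k <= v (2 * K)%N * K%:R by lra.
  by rewrite ler_pdivrMr// => h; lra.
- by lra.
- rewrite ler_pdivlMl ?mulr_gt0//.
  have : 8 * b%:R * (2 * block_bound m (block_coef m p v) (2 * K)) <= 16 * b%:R * B n.
    have -> : 16 * b%:R * B n = 8 * b%:R * (2 * B n) by ring.
    by rewrite ler_wpM2l ?mulr_ge0// ler_wpM2l.
  by lra.
Qed.
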